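(* Let $R$ be a ring and $C$ a left $R$-module. If $R$ is $\mathrm{G}_C\mathrm{F}$-closed and $C$ is a $w^+$-tilting $R$-module admitting a degreewise finite projective resolution, then $$\mathrm{G}_C\mathrm{F}(R)\cap\mathrm{G}_C\mathrm{C}(R)={}^\perp\left(\mathcal{B}_C(R)\cap\mathcal{C}_C(R)\right)\cap\left(\mathcal{B}_C(R)\cap\mathcal{C}_C(R)\right).$$
   Context: Rings are associative with identity; modules are unital left modules unless otherwise stated. $S=\mathrm{End}_R(C)$ acts on the right of $C$, so $C$ is an $(R,S)$-bimodule. A degreewise finite projective resolution is a projective resolution by finitely generated projective modules. $C^+=\mathrm{Hom}_{\mathbb Z}(C,\mathbb Q/\mathbb Z)$; $\mathrm{Prod}_R(C^+)$ is the class of right $R$-modules isomorphic to direct summands of direct products of copies of $C^+$. A left $R$-module $M$ is $\mathcal{F}_C$-flat if $M^+\in\mathrm{Prod}_R(C^+)$; the class of these is $\mathcal{F}_C(R)$. $M$ is $\mathcal{C}_C$-cotorsion if $\mathrm{Ext}^1_R(N,M)=0$ for all $N\in\mathcal{F}_C(R)$; the class is $\mathcal{C}_C(R)$. A complex $\mathbf X$ is $(\mathrm{Prod}_R(C^+)\otimes_R-)$-exact if $Y\otimes_R\mathbf X$ is exact for all $Y\in\mathrm{Prod}_R(C^+)$. For a class $\mathcal X$, ${}^\perp\mathcal X=\{M:\mathrm{Ext}^1_R(M,X)=0\ \forall X\in\mathcal X\}$. $C$ is $w^+$-tilting if $\mathrm{Tor}^R_i((C^+)^I,C)=0$ for every set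 $I$ and $i\geq1$, and there is an exact and $(\mathrm{Prod}_R(C^+)\otimes_R-)$-exact sequence $0\to R\to C_{-1}\to C_{-2}\to\cdots$ with all $C_i\in\mathcal{F}_C(R)$. A left $R$-module $M$ is $\mathrm{G}_C$-flat if there is an exact and $(\mathrm{Prod}_R(C^+)\otimes_R-)$-exact sequence $\cdots\to F_1\to F_0\to C_{-1}\to C_{-2}\to\cdots$ with all $F_j$ flat, all $C_i\in\mathcal{F}_C(R)$ and $M\cong\mathrm{Im}(F_0\to C_{-1})$; the class is $\mathrm{G}_C\mathrm{F}(R)$. $R$ is $\mathrm{G}_C\mathrm{F}$-closed if $\mathrm{G}_C\mathrm{F}(R)$ is closed under extensions. $M$ is $\mathrm{G}_C$-cotorsion if $\mathrm{Ext}_R^1(N,M)=0$ for all $\mathrm{G}_C$-flat $N$; the class is $\mathrm{G}_C\mathrm{C}(R)$. $\mathcal{B}_C(R)$ (Bass class) is the class of left $R$-modules $N$ with $\mathrm{Ext}_R^{\geq1}(C,N)=0=\mathrm{Tor}^S_{\geq1}(C,\mathrm{Hom}_R(C,N))$ and canonical map $C\otimes_S\mathrm{Hom}_R(C,N)\to N$ an isomorphism. *)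

(* Defs.v *)
From HB Require Import structures.
From mathcomp Require Import all_boot all_order all_algebra.
From mathcomp Require Import boolp functions.
From mathcomp Require Import generic_quotient ring_quotient freeg.

Set Implicit Arguments.
Unset Strict Implicit.
Unset Printing Implicit Defensive.

Import GRing.Theory Num.Theory.
Local Open Scope ring_scope.
Local Open Scope quotient_scope.

(* Rings are [pzRingType], so the zero ring is allowed (it does occur as       *)
(* [End_R(0)]).  Left R-modules are [lmodType R] and right R-modules are       *)
(* [lmodType R^c]: for [r : R] and [y] in a right module, [(r : R^c) *: y] is  *)
(* the product y r.                                                            *)

Definition module_class (R : pzRingType) := lmodType R -> Prop.

Definition capc (R : pzRingType) (X Y : module_class R) : module_class R :=
  fun M => X M /\ Y M.

Definition exact_at (A : Type) (B D : zmodType) (f : A -> B) (g : B -> D) :=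
  forall b, g b = 0 <-> exists a, f a = b.

(* [Num.int_num_subdef] is the predicate underlying [Num.int]. *)
Definition QmodZ : Type :=
  Quotient.quot (@Num.int_num_subdef rat : {pred rat}).
HB.instance Definition _ := GRing.Zmodule.on QmodZ.

Section CharacterModule.
Variables (R : pzRingType) (M : lmodType R).

Definition chr : Type := {additive M -> QmodZ}.
HB.instance Definition _ := gen_eqMixin chr.
HB.instance Definition _ := gen_choiceMixin chr.

Implicit Types (f g h : chr) (r : R).

Lemma chrP f g : (forall x, f x = g x) <-> f = g.
Proof.
split=> [|-> //].
case: f g => [f [[[f0 fD]]]] [g [[[g0 gD]]]] /= /funext fg.
by subst g; do 3 congr (_ _); exact: Prop_irrelevance.
Qed.

Definition chr_zero : chr := \0.
Definition chr_opp f : chr := \- f.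
Definition chr_add f g : chr := f \+ g.

Let addA : associative chr_add.
Proof. by move=> f g h; apply/chrP => x /=; rewrite addrA. Qed.
Let addC : commutative chr_add.
Proof. by move=> f g; apply/chrP => x /=; rewrite addrC. Qed.
Let add0 : left_id chr_zero chr_add.
Proof. by move=> f; apply/chrP => x /=; rewrite add0r. Qed.
Let addN : left_inverse chr_zero chr_opp chr_add.
Proof. by move=> f; apply/chrP => x /=; rewrite addNr. Qed.

HB.instance Definition _ := GRing.isZmodule.Build chr addA addC add0 addN.

Definition chr_scale (r : R^c) f : chr := f \o *:%R (r : R).

Let scaleA (a b : R^c) f : chr_scale a (chr_scale b f) = chr_scale (a * b) f.
Proof. by apply/chrP => x /=; rewrite scalerA. Qed.
Let scale1 : left_id (1 : R^c) chr_scale.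
Proof. by move=> f; apply/chrP => x /=; rewrite scale1r. Qed.
Let scaleDr : right_distributive chr_scale +%R.
Proof. by move=> a f g; apply/chrP. Qed.
Let scaleDl f : {morph chr_scale^~ f : a b / a + b}.
Proof. by move=> a b; apply/chrP => x /=; rewrite scalerDl raddfD. Qed.

HB.instance Definition _ :=
  GRing.Zmodule_isLmodule.Build R^c chr scaleA scale1 scaleDr scaleDl.

End CharacterModule.

Section Hom.
Variables (R : pzRingType) (M N : lmodType R).

Definition lhom : Type := {linear M -> N}.
HB.instance Definition _ := gen_eqMixin lhom.
HB.instance Definition _ := gen_choiceMixin lhom.

Implicit Types (f g h : lhom).

Lemma lhomP f g : (forall x, f x = g x) <-> f = g.
Proof.
split=> [|-> //].
case: f g => [f [[[f0 fD]] [fZ]]] [g [[[g0 gD]] [gZ]]] /= /funext fg.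
subst g; have -> : f0 = g0 by exact: Prop_irrelevance.
have -> : fD = gD by exact: Prop_irrelevance.
by have -> : fZ = gZ by exact: Prop_irrelevance.
Qed.

Definition lhom_zero : lhom := \0.
Definition lhom_opp f : lhom := \- f.
Definition lhom_add f g : lhom := f \+ g.

Let addA : associative lhom_add.
Proof. by move=> f g h; apply/lhomP => x /=; rewrite addrA. Qed.
Let addC : commutative lhom_add.
Proof. by move=> f g; apply/lhomP => x /=; rewrite addrC. Qed.
Let add0 : left_id lhom_zero lhom_add.
Proof. by move=> f; apply/lhomP => x /=; rewrite add0r. Qed.
Let addN : left_inverse lhom_zero lhom_opp lhom_add.
Proof. by move=> f; apply/lhomP => x /=; rewrite addNr. Qed.

HB.instance Definition _ := GRing.isZmodule.Build lhom addA addC add0 addN.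

End Hom.

(* The ring S = End_R(C), with the product for which C is an (R, S)-bimodule:  *)
(* endomorphisms act on the right, so (s t)(c) = t (s c).                      *)
Section End.
Variables (R : pzRingType) (C : lmodType R).

Definition endo : Type := lhom C C.
HB.instance Definition _ := GRing.Zmodule.on endo.

Implicit Types (s t u : endo).

Definition endo_one : endo := idfun.
Definition endo_mul s t : endo := (t : lhom C C) \o (s : lhom C C).

Let mulA : associative endo_mul.
Proof. by move=> s t u; apply/lhomP. Qed.
Let mul1 : left_id endo_one endo_mul.
Proof. by move=> s; apply/lhomP. Qed.
Let mulr1 : right_id endo_one endo_mul.
Proof. by move=> s; apply/lhomP. Qed.
Let mulDl : left_distributive endo_mul +%R.
Proof. by move=> s t u; apply/lhomP => x /=; rewrite raddfD. Qed.
Let mulDr : right_distributive endo_mul +%R.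
Proof. by move=> s t u; apply/lhomP. Qed.

HB.instance Definition _ :=
  GRing.Zmodule_isPzRing.Build endo mulA mul1 mulr1 mulDl mulDr.

(* C as a right S-module: c s = s(c). *)
Definition right_endo : Type := C.
HB.instance Definition _ := GRing.Zmodule.on right_endo.

Definition right_endo_scale (s : endo^c) (c : right_endo) : right_endo :=
  (s : lhom C C) (c : C).

Let rscaleA (a b : endo^c) (c : right_endo) :
  right_endo_scale a (right_endo_scale b c) = right_endo_scale (a * b) c.
Proof. by []. Qed.
Let rscale1 : left_id (1 : endo^c) right_endo_scale.
Proof. by []. Qed.
Let rscaleDr : right_distributive right_endo_scale +%R.
Proof. by move=> a c d; exact: raddfD. Qed.
Let rscaleDl c : {morph right_endo_scale^~ c : a b / a + b}.
Proof. by []. Qed.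

HB.instance Definition _ := GRing.Zmodule_isLmodule.Build endo^c right_endo
  rscaleA rscale1 rscaleDr rscaleDl.

(* Hom_R(C, N) as a left S-module: (s f)(c) = f(c s). *)
Variable N : lmodType R.

Definition hom_endo : Type := lhom C N.
HB.instance Definition _ := GRing.Zmodule.on hom_endo.

Definition hom_endo_scale (s : endo) (f : hom_endo) : hom_endo :=
  (f : lhom C N) \o (s : lhom C C).

Let hscaleA (s t : endo) (f : hom_endo) :
  hom_endo_scale s (hom_endo_scale t f) = hom_endo_scale (s * t) f.
Proof. by apply/lhomP. Qed.
Let hscale1 : left_id (1 : endo) hom_endo_scale.
Proof. by move=> f; apply/lhomP. Qed.
Let hscaleDr : right_distributive hom_endo_scale +%R.
Proof. by move=> s f g; apply/lhomP. Qed.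
Let hscaleDl f : {morph hom_endo_scale^~ f : s t / s + t}.
Proof. by move=> s t; apply/lhomP => x /=; exact: raddfD. Qed.

HB.instance Definition _ := GRing.Zmodule_isLmodule.Build endo hom_endo
  hscaleA hscale1 hscaleDr hscaleDl.

End End.

(* Y (x)_R M for a right module Y and a left module M, as the quotient of the  *)
(* free abelian group on Y * M by the subgroup generated by the usual          *)
(* relations.                                                                  *)
Section Tensor.
Variables (R : pzRingType) (Y : lmodType R^c) (M : lmodType R).

Inductive tens_rel : {freeg (Y * M)%type} -> Prop :=
| TensRel0 : tens_rel 0
| TensRelB a b : tens_rel a -> tens_rel b -> tens_rel (a - b)
| TensRelDl y y' x : tens_rel (<<(y + y', x)>> - <<(y, x)>> - <<(y', x)>>)
| TensRelDr y x x' : tens_rel (<<(y, x + x')>> - <<(y, x)>> - <<(y, x')>>)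
| TensRelZ (r : R) y x :
    tens_rel (<<((r : R^c) *: y, x)>> - <<(y, r *: x)>>).

Definition tens_relb : {pred {freeg (Y * M)%type}} :=
  fun a => `[< tens_rel a >].

Fact tens_rel_closed : zmod_closed tens_relb.
Proof.
split=> [|a b /asboolP ra /asboolP rb]; apply/asboolP; first exact: TensRel0.
exact: TensRelB.
Qed.
HB.instance Definition _ :=
  GRing.isZmodClosed.Build {freeg (Y * M)%type} tens_relb tens_rel_closed.

Definition tens : Type := Quotient.quot tens_relb.
HB.instance Definition _ := GRing.Zmodule.on tens.

Definition tmul (y : Y) (x : M) : tens :=
  \pi_(Quotient.quot tens_relb) <<(y, x)>>.

Definition balanced (A : zmodType) (b : Y -> M -> A) :=
  [/\ forall y y' x, b (y + y') x = b y x + b y' x,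
      forall y x x', b y (x + x') = b y x + b y x'
    & forall (r : R) y x, b ((r : R^c) *: y) x = b y (r *: x)].

Definition tlift (A : zmodType) (b : Y -> M -> A) (t : tens) : A :=
  fglift (fun p : (Y * M)%type => b p.1 p.2 : zmodule A)
    (repr (t : Quotient.quot tens_relb)).

Lemma tmul_balanced : balanced tmul.
Proof.
have E (a b : {freeg (Y * M)%type}) : tens_rel (a - b) ->
    \pi_(Quotient.quot tens_relb) a = \pi_(Quotient.quot tens_relb) b.
  by move=> ab; apply/eqP; rewrite -Quotient.idealrBE; apply/asboolP.
split=> [y y' x|y x x'|r y x]; last exact/E/TensRelZ.
- by rewrite /tmul -[RHS]raddfD; apply: E; rewrite opprD addrA; exact: TensRelDl.
- by rewrite /tmul -[RHS]raddfD; apply: E; rewrite opprD addrA; exact: TensRelDr.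
Qed.

Lemma tens_ind (P : tens -> Prop) :
  P 0 -> (forall t u, P t -> P u -> P (t + u)) -> (forall t, P t -> P (- t)) ->
  (forall y x, P (tmul y x)) -> forall t, P t.
Proof.
move=> P0 PD PN PU t; rewrite -[t](@reprK _ (Quotient.quot tens_relb)).
move: (repr _) => a; elim/freeg_ind_dom0: a => [|k [y x] D _ _ PD'].
  by rewrite raddf0.
rewrite raddfD; apply: (PD) => //.
have -> : <<k *g (y, x)>> = <<(y, x)>> *~ k.
  by apply/eqP/freeg_eqP => z; rewrite raddfMz /= !coeffU mul1r -mulrzl intz.
rewrite raddfMz; have PM n : P (tmul y x *+ n).
  by elim: n => [|n IHn]; rewrite ?mulr0n // mulrS; apply: (PD).
by case: k => n; [exact: PM | rewrite NegzE mulrNz; exact/PN/PM].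
Qed.

Section Lift.
Variables (A : zmodType) (b : Y -> M -> A).
Hypothesis b_bal : balanced b.

Let L := fglift (fun p : (Y * M)%type => b p.1 p.2 : zmodule A).
Let LB : zmod_morphism L. Proof. exact: lift_is_additive. Qed.
Let LU y x : L <<(y, x)>> = b y x.
Proof. by rewrite /L liftU scale1r. Qed.

Let L_rel a : tens_rel a -> L a = 0.
Proof.
case: b_bal => bDl bDr bZ.
elim=> [|{}a c _ La _ Lc|y y' x|y x x'|r y x]; rewrite ?LB ?LU.
- by rewrite -[0](subrr 0) LB subrr.
- by rewrite La Lc subrr.
- by rewrite bDl addrAC addrK subrr.
- by rewrite bDr addrAC addrK subrr.
- by rewrite bZ subrr.
Qed.

Let tlift_pi a : tlift b (\pi_(Quotient.quot tens_relb) a) = L a.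
Proof.
apply/subr0_eq; rewrite /tlift -/L -LB; apply: L_rel.
set p := \pi_(_) a; have : repr p - a \in tens_relb.
  by rewrite Quotient.idealrBE reprK.
by move/asboolP.
Qed.

Lemma tliftE y x : tlift b (tmul y x) = b y x.
Proof. by rewrite /tmul tlift_pi LU. Qed.

Lemma tlift_is_additive : zmod_morphism (tlift b).
Proof.
move=> t u; rewrite -[t](@reprK _ (Quotient.quot tens_relb)).
rewrite -[u](@reprK _ (Quotient.quot tens_relb)).
by rewrite -raddfB !tlift_pi LB.
Qed.

End Lift.

End Tensor.

Definition tmap (R : pzRingType) (Y Y' : lmodType R^c) (M M' : lmodType R)
    (f : {linear Y -> Y'}) (g : {linear M -> M'}) : tens Y M -> tens Y' M' :=
  tlift (fun y x => tmul (f y) (g x)).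

Lemma tmap_balanced (R : pzRingType) (Y Y' : lmodType R^c) (M M' : lmodType R)
    (f : {linear Y -> Y'}) (g : {linear M -> M'}) :
  balanced (fun y x => tmul (f y) (g x)).
Proof.
case: (tmul_balanced Y' M') => mDl mDr mZ.
by split=> *; rewrite ?linearZ ?raddfD ?mDl ?mDr ?mZ.
Qed.

Lemma tmapE (R : pzRingType) (Y Y' : lmodType R^c) (M M' : lmodType R)
    (f : {linear Y -> Y'}) (g : {linear M -> M'}) (y : Y) (x : M) :
  tmap f g (tmul y x) = tmul (f y) (g x).
Proof. exact/tliftE/tmap_balanced. Qed.

Lemma tmap_is_additive (R : pzRingType) (Y Y' : lmodType R^c)
    (M M' : lmodType R) (f : {linear Y -> Y'}) (g : {linear M -> M'}) :
  zmod_morphism (tmap f g).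
Proof. exact/tlift_is_additive/tmap_balanced. Qed.

Definition ltens (R : pzRingType) (Y : lmodType R^c) (M M' : lmodType R)
    (g : {linear M -> M'}) : tens Y M -> tens Y M' :=
  tmap (idfun : {linear Y -> Y}) g.
Arguments ltens {R} Y {M M'} g.

Section HomologicalAlgebra.
Variable R : pzRingType.
Implicit Types (M N : lmodType R) (Y : lmodType R^c).

Definition projective M := forall (A B : lmodType R) (p : {linear A -> B})
  (f : {linear M -> B}), (forall b, exists a, p a = b) ->
  exists g : {linear M -> A}, forall x, p (g x) = f x.

Definition finitely_generated M := exists (n : nat) (v : 'I_n -> M),
  forall x, exists r : 'I_n -> R, x = \sum_i r i *: v i.

Definition flat M := forall (A B : lmodType R^c) (f : {linear A -> B}),
  injective f -> injective (tmap f (idfun : {linear M -> M})).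

Definition projective_resolution M (P : nat -> lmodType R)
    (d : forall n, {linear P n.+1 -> P n}) (e : {linear P 0%N -> M}) :=
  [/\ forall n, projective (P n),
      forall x, exists y, e y = x,
      exact_at (d 0%N) e
    & forall n, exact_at (d n.+1) (d n)].

Definition degreewise_finite_projective_resolution M :=
  exists (P : nat -> lmodType R) (d : forall n, {linear P n.+1 -> P n})
         (e : {linear P 0%N -> M}),
    projective_resolution d e /\ forall n, finitely_generated (P n).

(* Ext and Tor are computed from projective resolutions P -> M; vanishing in   *)
(* degree i is exactness in degree i of Hom_R(P, N), resp. Y (x)_R P, which    *)
(* does not depend on the resolution.                                          *)
Definition Ext_eq0 (i : nat) M N :=
  forall (P : nat -> lmodType R) (d : forall n, {linear P n.+1 -> P n})
         (e : {linear P 0%N -> M}), projective_resolution d e ->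
  match i with
  | 0 => forall f : {linear P 0%N -> N},
      (forall x, f (d 0%N x) = 0) -> forall x, f x = 0
  | j.+1 => forall f : {linear P j.+1 -> N},
      (forall x, f (d j.+1 x) = 0) ->
      exists g : {linear P j -> N}, forall x, f x = g (d j x)
  end.

Definition Tor_eq0 (i : nat) Y M :=
  forall (P : nat -> lmodType R) (d : forall n, {linear P n.+1 -> P n})
         (e : {linear P 0%N -> M}), projective_resolution d e ->
  match i with
  | 0 => forall t, exists u, ltens Y (d 0%N) u = t
  | j.+1 => exact_at (ltens Y (d j.+1)) (ltens Y (d j))
  end.

Definition short_exact (A B D : lmodType R) (f : {linear A -> B})
    (g : {linear B -> D}) :=
  [/\ injective f, exact_at f g & forall z, exists y, g y = z].

Definition extension_closed (X : module_class R) :=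
  forall (A B D : lmodType R) (f : {linear A -> B}) (g : {linear B -> D}),
    short_exact f g -> X A -> X D -> X B.

Definition left_orth (X : module_class R) : module_class R :=
  fun M => forall N, X N -> Ext_eq0 1 M N.

End HomologicalAlgebra.

Section RelativeToC.
Variables (R : pzRingType) (C : lmodType R).

Definition Prod_chr (Y : lmodType R^c) :=
  exists (I : Type) (Z : lmodType R^c) (f : {linear (Y * Z)%type -> (I -> chr C)}),
    bijective f.

Definition FC_flat : module_class R := fun M => Prod_chr (chr M).

Definition CC_cotorsion : module_class R :=
  fun M => forall N, FC_flat N -> Ext_eq0 1 N M.

(* The coresolution is 0 -> R -> D 0 -> D 1 -> ..., with D n = C_{-(n+1)}. *)
Definition wplus_tilting :=
  (forall (I : Type) (i : nat), (1 <= i)%N -> Tor_eq0 i (I -> chr C) C) /\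
  exists (D : nat -> lmodType R) (e : {linear R^o -> D 0%N})
         (d : forall n, {linear D n -> D n.+1}),
    [/\ forall n, FC_flat (D n),
        [/\ injective e, exact_at e (d 0%N)
          & forall n, exact_at (d n) (d n.+1)]
      & forall Y, Prod_chr Y ->
        [/\ injective (ltens Y e), exact_at (ltens Y e) (ltens Y (d 0%N))
          & forall n, exact_at (ltens Y (d n)) (ltens Y (d n.+1))]].

(* The two-sided sequence is a complex X indexed by int with X i = F_i for     *)
(* i >= 0 and X i = C_i for i < 0, so that d (-1) is the map F_0 -> C_{-1}.    *)
Definition GC_flat : module_class R := fun M =>
  exists (X : int -> lmodType R) (d : forall i, {linear X (i + 1) -> X i}),
    [/\ forall i, 0 <= i -> flat (X i),
        forall i, i < 0 -> FC_flat (X i),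
        forall i, exact_at (d (i + 1)) (d i),
        forall Y, Prod_chr Y ->
          forall i, exact_at (ltens Y (d (i + 1))) (ltens Y (d i))
      & exists f : {linear M -> X (-1)}, injective f /\
          forall x, (exists m, f m = x) <-> (exists y, d (-1) y = x)].

Definition GCF_closed := extension_closed GC_flat.

Definition GC_cotorsion : module_class R :=
  fun M => forall N, GC_flat N -> Ext_eq0 1 N M.

(* The canonical map C (x)_S Hom_R(C, N) -> N, c (x) f |-> f c. *)
Definition bass_eval (N : lmodType R) :
    tens (R := endo C) (right_endo C) (hom_endo C N) -> N :=
  tlift (fun (c : right_endo C) (f : hom_endo C N) => (f : lhom C N) (c : C)).

Lemma bass_evalE (N : lmodType R) (c : right_endo C) (f : hom_endo C N) :
  bass_eval (tmul c f) = (f : lhom C N) (c : C).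
Proof.
apply: tliftE; split=> [c1 c2 g|c1 g1 g2|s c1 g] //=; exact: raddfD.
Qed.

Definition bass : module_class R := fun N =>
  [/\ forall i, (1 <= i)%N -> Ext_eq0 i C N,
      forall i, (1 <= i)%N ->
        Tor_eq0 (R := endo C) i (right_endo C) (hom_endo C N)
    & bijective (bass_eval (N := N))].

End RelativeToC.

(* Main.v *)
(* Both sides equal F_C ∩ C_C.

   - Left side.  If M is in F_C ∩ C_C and 0 -> M -> E -> N -> 0 is exact with N
     G_C-flat, then E is G_C-flat, so E embeds in some D in F_C and Q = D/M is
     G_C-flat as an extension of D/E by N.  Embed Q in D' in F_C.  Since
     Tor_1(M^+, Q) = 0, the map Q^+ (x) Q -> D^+ (x) Q -> D^+ (x) D' is
     injective, hence so is Q^+ (x) Q -> Q^+ (x) D'; the evaluation character of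
     Q^+ (x) Q then extends to Q^+ (x) D', i.e. D'^+ -> Q^+ splits.  So Q is in
     F_C, the inclusion M -> D splits, and no complete cotorsion pair is needed.

   - Bass class.  Because extensions of G_C-flat modules are G_C-flat, the
     coresolution of R by F_C-modules can be replaced by one of the form
     X : 0 -> R -> C^n0 -> C^n1 -> ...; applying Hom_R(-, C) gives a free
     resolution of C over S by finitely generated modules.  Hence N is in B_C
     iff Ext^i(C, N) = 0 for i >= 1 and Hom_R(X, N) is exact, and this property
     passes from N to N^++.

   - Right side.  For M in B_C let L be the kernel of the canonical surjection
     C^(J) -> M.  Then L is in B_C and L^++ is in B_C ∩ C_C, so Ext^1(M, L^++) =
     0 extends L -> L^++ to C^(J), which splits (C^(J))^+ -> L^+ and makes M^+ a
     summand of (C^+)^J.                                                       *)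

Require Import Defs.
From HB Require Import structures.
From mathcomp Require Import all_boot all_order all_algebra.
From mathcomp Require Import boolp functions classical_sets.

Set Implicit Arguments.
Unset Strict Implicit.
Unset Printing Implicit Defensive.

Import GRing.Theory Num.Theory.
Local Open Scope classical_set_scope.
Local Open Scope ring_scope.
Local Open Scope quotient_scope.

(** * Characters of abelian groups *)

(** Two dualities carry the argument. A character of [Y (x) M] is a linear map [Y -> M^+], and also
    a linear map [M -> Y^+]. As Q/Z is an injective cogenerator, exactness after tensoring becomes a
    factorization statement, and vanishing of Tor(Y, M) becomes vanishing of Ext(Y, M^+). In this
    form products and summands in [M^+] pass through, so a vanishing for [C] reaches all of F_C. The
    second duality, [D^+ (x) U] against Hom(U, D), needs finite presentation; there the finite
    resolution of [C] enters, turning Ext(C, N) into Tor(N^+, C) and Hom(X, N) into [N^+ (x) X].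
    Composing both moves a property from N to N^++. The obstacle is that the F_C-modules in the
    given coresolution of R need not be finitely presented and are tied to [C] only through
    characters. A map to such a module from a finitely presented one factors through a finite power
    of [C], as maps to flat modules factor through finite free ones. The cokernel of the map into
    that power is shown to be G_C-flat after adding a module of F_C, so a summand is carried along
    the induction. *)

Lemma QmodZ_divisible (x : QmodZ) (m : nat) : (0 < m)%N -> exists y, y *+ m = x.
Proof.
move=> m0; exists (\pi_QmodZ (repr x / m%:R)).
rewrite -raddfMn /= -[_ *+ m]mulr_natr divfK ?pnatr_eq0 -?lt0n //; exact: reprK.
Qed.

Lemma QmodZ_pi_eq0 (r : rat) : (\pi_QmodZ r == 0) = (r \is a Num.int).
Proof.
have := Quotient.idealrBE (@Num.int_num_subdef rat : {pred rat}) r 0.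
by rewrite subr0 raddf0 => <-.
Qed.

Section SubgroupInt.
Variables (D : zmodType) (K : D -> Prop).
Hypothesis KB : forall x y, K x -> K y -> K (x - y).
Hypothesis K0 : K 0.

(* [m = 0] when no positive multiple of [d] lies in [K]. *)
Lemma cyclic_order_mod (d : D) :
  exists m : nat, K (d *+ m) /\ forall k : int, K (d *~ k) -> exists l : int, k = l * m%:Z.
Proof.
have KN x : K x -> K (- x) by move=> Kx; rewrite -[- x]sub0r; apply: KB.
have KD x y : K x -> K y -> K (x + y) by move=> Kx Ky; rewrite -[y]opprK; apply/KB/KN.
have KM x (n : nat) : K x -> K (x *+ n).
  by move=> Kx; elim: n => [|n IH]; rewrite ?mulr0n // mulrS; apply: KD.
have KZ x (n : int) : K x -> K (x *~ n).
  by move=> Kx; case: n => n; rewrite ?NegzE ?mulrNz; [|apply: KN]; apply: KM.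
case: (pselect (exists m, (0 < m)%N && `[< K (d *+ m) >])) => [ex|nex].
  case: (ex_minnP ex) => m /andP[m0 /asboolP Km] mmin; exists m; split=> // k Kk.
  exists (k %/ m)%Z; rewrite {1}(divz_eq k m); apply/eqP; rewrite addrC -subr_eq0 addrK.
  apply/eqP.
  have mz : m%:Z != 0 by rewrite eqz_nat -lt0n.
  have r0 := modz_ge0 k mz; have rm := ltz_pmod k (m0 : 0 < m%:Z).
  have Kr : K (d *~ (k %% m)%Z).
    have -> : (k %% m)%Z = k - (k %/ m)%Z * m%:Z by rewrite {2}(divz_eq k m) addrC addKr.
    rewrite mulrzBr; apply: KB => //; rewrite mulrC mulrzA; exact: KZ.
  case: (k %% m)%Z r0 rm Kr => // r _ rm Kr.
  case: r rm Kr => // r; rewrite ltz_nat ltnNge => rm Kr; move: (mmin r.+1).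
  by rewrite (asboolT Kr) => /(_ isT); rewrite (negPf rm).
exists 0%N; rewrite mulr0n; split=> // k Kk; exists 0; rewrite mul0r.
apply: contrapT => k0; apply: nex; exists `|k|%N; rewrite lt0n absz_eq0.
apply/andP; split; [exact/eqP|apply/asboolP].
case: k Kk {k0} => k; rewrite ?NegzE //= mulrNz => /KN; rewrite opprK //.
Qed.

End SubgroupInt.

Section CharacterExtension.
Variables (B D : zmodType) (g : {additive B -> D}) (phi : {additive B -> QmodZ}).
Hypothesis gphi : forall b, g b = 0 -> phi b = 0.

(** A subgroup with zero fibre over 0 is the graph of a character of a subgroup of [D]. *)
Let good (G : set (D * QmodZ)%type) :=
  (forall p q, G p -> G q -> G (p - q)) /\ (forall q, G (0, q) -> q = 0).
Let G0 : set (D * QmodZ)%type := [set p | exists b, p = (g b, phi b)].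

Let good_G0 : good G0.
Proof.
split=> [_ _ [b ->] [b' ->]|q [b [gb ->]]]; last exact/gphi/esym.
by exists (b - b'); rewrite !raddfB.
Qed.

Let max_good : exists G, [/\ good G, G0 `<=` G &
  forall G', good G' -> G `<=` G' -> G' `<=` G].
Proof.
(* With [G0] adjoined inside the predicate, the empty chain also has a good upper bound, as Zorn's
   lemma requires here. *)
pose P X := good (X `|` G0).
have [X [PX Xmax]] : exists X, P X /\ forall Y, X `<` Y -> ~ P Y.
  apply: Zorn_bigcup => F FP Ftot; split=> [p q|q].
    have GX X : F X -> X `|` G0 `<=` (\bigcup_(X in F) X) `|` G0.
      by move=> FX x [Xx|]; [left; exists X|right].
    have E p' : ((\bigcup_(X in F) X) `|` G0) p' -> G0 p' \/ exists2 X, F X & X p'.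
      by case=> [[X FX Xp]|]; [right; exists X|left].
    move=> /E[Gp|[X FX Xp]] /E[Gq|[Y FY Yq]].
    - by right; apply: good_G0.1.
    - by apply: (GX Y FY); apply: (FP Y FY).1; [right|left].
    - by apply: (GX X FX); apply: (FP X FX).1; [left|right].
    - have [XY|YX] := Ftot _ _ FX FY.
        by apply: (GX Y FY); apply: (FP Y FY).1; left => //; apply: XY.
      by apply: (GX X FX); apply: (FP X FX).1; left => //; apply: YX.
  by move=> [[X FX Xq]|]; [apply: (FP X FX).2; left|apply: good_G0.2].
exists (X `|` G0); split=> [//|p|G' G'g XG']; first by right.
case: (pselect (G' `<=` X)) => [G'X p /G'X|nG'X]; first by left.
exfalso; apply: (Xmax G'); first by split=> // p Xp; apply: XG'; left.
rewrite /P; suff -> : G' `|` G0 = G' by [].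
by apply/seteqP; split=> p; [case=> // Gp; apply: XG'; right|left].
Qed.

(** Injectivity of Q/Z: a maximal graph is total because Q/Z is divisible. [g] may have a kernel, as
    long as [phi] kills it. *)
Lemma character_extension : exists psi : {additive D -> QmodZ}, forall b, psi (g b) = phi b.
Proof.
have [G [[GB Gz] G0G Gmax]] := max_good.
have G00 : G 0 by apply: G0G; exists 0; rewrite !raddf0.
have GN p : G p -> G (- p) by move=> Gp; rewrite -[- p]sub0r; apply: GB.
have GD p q : G p -> G q -> G (p + q).
  by move=> Gp Gq; rewrite -[q]opprK; apply/GB/GN.
have GM p (n : nat) : G p -> G (p *+ n).
  by move=> Gp; elim: n => [|n IH]; rewrite ?mulr0n // mulrS; apply: GD.
have GZ p (n : int) : G p -> G (p *~ n).
  by move=> Gp; case: n => n; rewrite ?NegzE ?mulrNz; [|apply: GN]; apply: GM.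
have pairM (x : D) (y : QmodZ) n : (x, y) *+ n = (x *+ n, y *+ n).
  by elim: n => [|n IH]; rewrite ?mulr0n // !mulrS IH.
have pairZ (x : D) (y : QmodZ) n : (x, y) *~ n = (x *~ n, y *~ n).
  by case: n => n; rewrite ?NegzE ?mulrNz -!pmulrn pairM.
have Gtot d : exists q, G (d, q).
  have [||m [[q0 Gq0] mP]] := @cyclic_order_mod D (fun x => exists q, G (x, q)) _ _ d.
  - by move=> x y [p Gp] [q Gq]; exists (p - q); apply: (GB _ _ Gp Gq).
  - by exists 0.
  (* The multiples of [d] in the domain are those of [d *+ m], whose value is already [q0]. A value
     [c] at [d] is therefore consistent once [c *+ m = q0]; if [m = 0], then [q0] is the value at 0,
     hence 0. *)
  have [c cm] : exists c, c *+ m = q0.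
    case: m Gq0 {mP} => [|m] Gq0; last exact: QmodZ_divisible.
    by exists 0; rewrite mulr0n; apply/esym/Gz.
  exists c.
  pose G' : set (D * QmodZ)%type := [set p | exists2 x, G x & exists k, p = x + (d, c) *~ k].
  apply: (Gmax G'); last by exists 0 => //; exists 1; rewrite mulr1z add0r.
    split=> [_ _ [x Gx [k ->]] [y Gy [l ->]]|q [[x y] Gx [k /eqP]]].
      exists (x - y); first exact: GB.
      by exists (k - l); rewrite mulrzBr opprD addrACA.
    rewrite pairZ => /eqP[xk ->].
    have [|l kl] := mP (- k).
      by exists y; rewrite mulrNz -[- _]add0r {1}xk addrK.
    have := GB _ _ Gx (GZ _ l Gq0).
    rewrite pairZ => H; apply: Gz.
    suff <- : (x, y) - (d *+ m *~ l, q0 *~ l) = (0, y + c *~ k) by [].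
    have -> : k = - (l * m%:Z) by rewrite -kl opprK.
    have E (T : zmodType) (t : T) : t *+ m *~ l = - (t *~ - (l * m%:Z)).
      by rewrite mulrNz opprK mulrC mulrzA -pmulrn.
    by rewrite -cm !E -{1}kl opprK; congr (_, _) => /=; rewrite /= opprK.
  by move=> p Gp; exists p => //; exists 0; rewrite mulr0z addr0.
have /choice[psi psiP] := Gtot.
have Gfun d p q : G (d, p) -> G (d, q) -> p = q.
  move=> /GB H /H H'; apply/eqP; rewrite -subr_eq0; apply/eqP/Gz.
  by rewrite -(subrr d).
have psiB : zmod_morphism psi.
  by move=> x y; apply: Gfun (psiP _) (GB _ _ (psiP _) (psiP _)).
pose psi_a := GRing.isZmodMorphism.Build _ _ psi psiB.
exists (HB.pack_for {additive D -> QmodZ} psi psi_a) => b /=.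
by apply: Gfun (psiP _) _; apply: G0G; exists b.
Qed.

End CharacterExtension.

Definition mk_additive (U V : zmodType) (f : U -> V) (fB : zmod_morphism f) :
  {additive U -> V} :=
  HB.pack_for {additive U -> V} f (GRing.isZmodMorphism.Build U V f fB).

Lemma mk_linear_subproof (R : pzRingType) (U V : lmodType R) (f : U -> V) :
  linear f -> zmod_morphism f * scalable f.
Proof.
move=> fL; split=> [x y|a x]; last first.
  have f0 : f 0 = 0.
    by apply: (@addIr _ (f 0)); rewrite add0r -{1}[f 0]scale1r -fL scale1r addr0.
  by rewrite -[a *: x]addr0 fL f0 addr0.
by rewrite addrC -scaleN1r fL scaleN1r addrC.
Qed.

Definition mk_linear (R : pzRingType) (U V : lmodType R) (f : U -> V) (fL : linear f) :
  {linear U -> V} :=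
  HB.pack_for {linear U -> V} f
   (GRing.isZmodMorphism.Build U V f (mk_linear_subproof fL).1)
   (GRing.isScalable.Build R U V *:%R f (mk_linear_subproof fL).2).

(** * Q/Z as a cogenerator, and exactness tested on characters *)

Section Coexact.

Lemma character_separation (A B : zmodType) (f : {additive A -> B}) (b : B) :
  (forall a, f a <> b) ->
  exists2 phi : {additive B -> QmodZ}, forall a, phi (f a) = 0 & phi b <> 0.
Proof.
move=> fb; have [||m [[a am] mP]] := @cyclic_order_mod B (fun x => exists a, f a = x) _ _ b.
- by move=> _ _ [x <-] [y <-]; exists (x - y); rewrite raddfB.
- by exists 0; rewrite raddf0.
have m1 : m != 1 by apply/eqP => m1; rewrite m1 mulr1n in am; exact: (fb a).
(* [n] is the order of [b] modulo the image of [f], or 2 if that order is infinite; then [1/n] is a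
   nonzero value that [b] may take. *)
have [n n1 nm] : exists2 n, (1 < n)%N &
    forall l : int, (\pi_QmodZ n%:R^-1 : QmodZ) *~ (l * m%:Z) = 0.
  case: m m1 {am mP} => [|m] m1; first by exists 2 => // l; rewrite mulr0.
  exists m.+1; first by case: m m1.
  move=> l; rewrite mulrC mulrzA -pmulrn -raddfMn /= -[_ *+ _]mulr_natr mulVf ?pnatr_eq0 //.
  suff -> : \pi_QmodZ 1 = 0 by rewrite mul0rz.
  by apply/eqP; rewrite QmodZ_pi_eq0 rpred1.
pose u : QmodZ := \pi_QmodZ n%:R^-1.
have u0 : u <> 0.
  apply/eqP; rewrite QmodZ_pi_eq0; apply/negP => /intrP[k /eqP].
  have n0 : n%:R != 0 :> rat by rewrite pnatr_eq0 -lt0n ltnW.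
  rewrite -(inj_eq (mulIf n0)) mulVf // -(intrM _ k n) (inj_eq intr_inj 1).
  move=> /eqP E; have := congr1 absz E; rewrite abszM /= => /esym/eqP.
  by rewrite muln_eq1 => /andP[_ /eqP E']; rewrite E' in n1.
(* The character is prescribed on [A * int], which maps onto the subgroup generated by [b] and the
   image of [f]; being well defined on that subgroup is the kernel condition of
   [character_extension]. *)
have gB : zmod_morphism (fun p : (A * int)%type => f p.1 + b *~ p.2).
  by move=> [x k] [y l] /=; rewrite raddfB mulrzBr opprD addrACA.
have uB : zmod_morphism (fun p : (A * int)%type => u *~ p.2).
  by move=> [x k] [y l] /=; rewrite mulrzBr.
have [|phi phiP] := @character_extension _ _ (mk_additive gB) (mk_additive uB).
  move=> [x k] /= xk; have [|l ->] := mP k; last exact: nm.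
  by exists (- x); rewrite raddfN; apply/eqP; rewrite eqr_oppLR -subr_eq0 opprK xk.
exists phi => [x|].
  by have /= := phiP (x, 0); rewrite !mulr0z addr0.
by have /= := phiP (0, 1); rewrite !mulr1z raddf0 add0r => ->.
Qed.

(** Exactness at [B^+] of the character sequence [D^+ -> B^+ -> A^+]. For tensor products this side
    is accessible, since their characters are linear maps. *)
Definition coexact (A : Type) (B D : zmodType) (f : A -> B) (g : B -> D) :=
  forall phi : {additive B -> QmodZ}, (forall a, phi (f a) = 0) <->
    exists psi : {additive D -> QmodZ}, forall b, phi b = psi (g b).

Lemma character_eq0 (B : zmodType) (b : B) :
  (forall phi : {additive B -> QmodZ}, phi b = 0) -> b = 0.
Proof.
move=> H; apply: contrapT => b0.
have [] := @character_separation B B (\0 : {additive B -> B}) b.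
  by move=> a /= E; apply: b0.
by move=> phi _; rewrite H.
Qed.

Variables (A B D : zmodType) (f : {additive A -> B}) (g : {additive B -> D}).

Lemma exact_coexact : exact_at f g <-> coexact f g.
Proof.
split=> [fg phi|fg b].
  split=> [phif|[psi H] a]; last by rewrite H (fg (f a)).2 ?raddf0 //; exists a.
  have [|psi H] := @character_extension B D g phi.
    by move=> b /fg[a <-].
  by exists psi.
split=> [gb|[a <-]]; last first.
  apply: character_eq0 => phi.
  have [_ /(_ _ a) H] := fg (phi \o g : {additive _ -> _}).
  by apply: H; exists phi.
apply: contrapT => nb.
have [|phi phif phib] := @character_separation A B f b.
  by move=> a fa; apply: nb; exists a.
have [/(_ phif)[psi H] _] := fg phi.
by apply: phib; rewrite H gb raddf0.
Qed.

Lemma character_injective :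
  injective g <-> forall phi : {additive B -> QmodZ}, exists psi : {additive D -> QmodZ},
    forall b, psi (g b) = phi b.
Proof.
split=> [gI phi|H].
  by apply: character_extension => b /eqP; rewrite -(raddf0 g) => /eqP/gI ->; rewrite raddf0.
apply: raddf_inj => b gb; apply: character_eq0 => phi; have [psi <-] := H phi.
by rewrite gb raddf0.
Qed.

End Coexact.

Arguments mk_additive : simpl never.
Arguments mk_linear : simpl never.

Lemma mk_additiveE (U V : zmodType) (f : U -> V) (fB : zmod_morphism f) x :
  mk_additive fB x = f x.
Proof. by []. Qed.

Lemma mk_linearE (R : pzRingType) (U V : lmodType R) (f : U -> V) (fL : linear f) x :
  mk_linear fL x = f x.
Proof. by []. Qed.

(** * Submodules, quotients, direct sums *)

Section Submodule.
Variables (R : pzRingType) (V : lmodType R).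

Record submodule := Submodule {
  submodule_pred : V -> Prop;
  submodule0 : submodule_pred 0;
  submodule_lin : forall a x y,
    submodule_pred x -> submodule_pred y -> submodule_pred (a *: x + y) }.

Variable U : submodule.

Definition submodule_mem : {pred V} := fun x => `[< submodule_pred U x >].

Fact submodule_mem_closed : submod_closed submodule_mem.
Proof.
split=> [|a x y /asboolP Ux /asboolP Uy]; apply/asboolP; first exact: submodule0.
exact: submodule_lin.
Qed.
HB.instance Definition _ := GRing.isSubmodClosed.Build R V submodule_mem submodule_mem_closed.

Record subm := Subm { subm_val : V; _ : subm_val \in submodule_mem }.
HB.instance Definition _ := [isSub for subm_val].
HB.instance Definition _ := [Choice of subm by <:].
HB.instance Definition _ := [SubChoice_isSubLmodule of subm by <:].

Fact subm_val_linear : linear subm_val.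
Proof. by move=> a x y; exact: (linearP (val : {linear subm -> V})). Qed.
Definition subm_incl : {linear subm -> V} := mk_linear subm_val_linear.

Lemma subm_inclP x : submodule_pred U (subm_incl x).
Proof. exact/asboolP/(valP x). Qed.

Lemma subm_incl_inj : injective subm_incl. Proof. exact: val_inj. Qed.

Lemma subm_incl_onto x : submodule_pred U x -> exists y, subm_incl y = x.
Proof. by move=> /asboolP Ux; exists (Subm Ux). Qed.

Definition quotm : Type := Quotient.quot submodule_mem.
HB.instance Definition _ := GRing.Zmodule.on quotm.

Definition quotm_pi (x : V) : quotm := \pi_(Quotient.quot submodule_mem) x.

Lemma quotm_piP x y : quotm_pi x = quotm_pi y <-> submodule_pred U (x - y).
Proof.
have := Quotient.idealrBE submodule_mem x y.
by move=> E; split=> [/eqP|/asboolP Uxy]; [rewrite -[_ == _]E => /asboolP|apply/eqP; rewrite -[_ == _]E].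
Qed.

Lemma quotm_pi_onto x : exists y, quotm_pi y = x.
Proof. by exists (repr (x : Quotient.quot submodule_mem)); rewrite /quotm_pi reprK. Qed.

Lemma quotm_piD x y : quotm_pi (x + y) = quotm_pi x + quotm_pi y.
Proof. exact: raddfD. Qed.

Definition quotm_scale (a : R) (x : quotm) : quotm :=
  quotm_pi (a *: repr (x : Quotient.quot submodule_mem)).

Lemma quotm_scaleE a x : quotm_scale a (quotm_pi x) = quotm_pi (a *: x).
Proof.
apply/quotm_piP; rewrite -scalerBr -[_ *: _]addr0; apply: submodule_lin (submodule0 U).
by apply/quotm_piP; rewrite [LHS]reprK.
Qed.

Let scaleA a b x : quotm_scale a (quotm_scale b x) = quotm_scale (a * b) x.
Proof. by have [y <-] := quotm_pi_onto x; rewrite !quotm_scaleE scalerA. Qed.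
Let scale1 : left_id 1 quotm_scale.
Proof. by move=> x; have [y <-] := quotm_pi_onto x; rewrite quotm_scaleE scale1r. Qed.
Let scaleDr : right_distributive quotm_scale +%R.
Proof.
move=> a x y; have [x' <-] := quotm_pi_onto x; have [y' <-] := quotm_pi_onto y.
by rewrite -quotm_piD !quotm_scaleE scalerDr quotm_piD.
Qed.
Let scaleDl x : {morph quotm_scale^~ x : a b / a + b}.
Proof.
move=> a b; have [y <-] := quotm_pi_onto x.
by rewrite !quotm_scaleE scalerDl quotm_piD.
Qed.
HB.instance Definition _ :=
  GRing.Zmodule_isLmodule.Build R quotm scaleA scale1 scaleDr scaleDl.

Fact quotm_pi_linear : linear quotm_pi.
Proof. by move=> a x y; rewrite quotm_piD -quotm_scaleE. Qed.
Definition quotm_proj : {linear V -> quotm} := mk_linear quotm_pi_linear.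

End Submodule.

Section LinearMaps.
Variable R : pzRingType.
Implicit Types A B D N P : lmodType R.

Fact pair_linear A B D (f : {linear A -> B}) (g : {linear A -> D}) :
  linear (fun x => (f x, g x) : (B * D)%type).
Proof. by move=> a x y; rewrite !linearP. Qed.
Definition pair_lin A B D (f : {linear A -> B}) (g : {linear A -> D}) :
  {linear A -> (B * D)%type} := mk_linear (pair_linear f g).

Fact copair_linear A B D (f : {linear A -> D}) (g : {linear B -> D}) :
  linear (fun p : (A * B)%type => f p.1 + g p.2).
Proof. by move=> a x y /=; rewrite !linearP scalerDr addrACA. Qed.
Definition copair_lin A B D (f : {linear A -> D}) (g : {linear B -> D}) :
  {linear (A * B)%type -> D} := mk_linear (copair_linear f g).

Fact scale_linear A (x : A) : linear (fun r : R^o => (r : R) *: x).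
Proof. by move=> a r s; rewrite scalerDl scalerA. Qed.
Definition scale_lin A (x : A) : {linear R^o -> A} := mk_linear (scale_linear x).

Lemma linear_eq0 A B (f : {linear A -> B}) :
  (forall x, f x = 0 -> x = 0) -> injective f.
Proof. by move=> f0; exact: raddf_inj. Qed.

Lemma linear_factor A B N (g : {linear A -> B}) (h : {linear A -> N}) :
  (forall b, exists a, g a = b) -> (forall a, g a = 0 -> h a = 0) ->
  exists h' : {linear B -> N}, forall a, h' (g a) = h a.
Proof.
move=> /choice[s gs] gh.
have hs a b : g a = b -> h (s b) = h a.
  move=> gab; apply/eqP; rewrite -subr_eq0 -raddfB; apply/eqP/gh.
  by rewrite linearB gs gab subrr.
have hsL : linear (fun b => h (s b)).
  by move=> r x y; rewrite (hs (r *: s x + s y) (r *: x + y)) linearP ?gs.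
by exists (mk_linear hsL) => a; exact: hs.
Qed.

Lemma linear_cofactor A B N (i : {linear A -> B}) (h : {linear N -> B}) :
  injective i -> (forall x, exists a, i a = h x) ->
  exists h' : {linear N -> A}, forall x, i (h' x) = h x.
Proof.
move=> iI /choice[s is_].
have sL : linear s by move=> r x y; apply: iI; rewrite linearP !is_ linearP.
by exists (mk_linear sL).
Qed.

Fact kernel_closed A B (f : {linear A -> B}) a x y :
  f x = 0 -> f y = 0 -> f (a *: x + y) = 0.
Proof. by rewrite linearP => -> ->; rewrite scaler0 addr0. Qed.
Definition kernel A B (f : {linear A -> B}) : submodule A :=
  Submodule (raddf0 f) (@kernel_closed A B f).

Lemma kernel_exact A B (f : {linear A -> B}) : exact_at (subm_incl (kernel f)) f.
Proof.
split=> [fb|[y <-]]; last exact: (subm_inclP y).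
exact: (@subm_incl_onto _ _ (kernel f)).
Qed.

Lemma kernel_exists A B (f : {linear A -> B}) : exists (L : lmodType R) (i : {linear L -> A}),
  injective i /\ exact_at i f.
Proof.
exists (subm (kernel f)), (subm_incl (kernel f)).
by split; [exact: subm_incl_inj|exact: kernel_exact].
Qed.

Fact lin_image0 A B (f : {linear A -> B}) : exists x, f x = 0.
Proof. by exists 0; rewrite raddf0. Qed.
Fact lin_image_closed A B (f : {linear A -> B}) a x y :
  (exists z, f z = x) -> (exists z, f z = y) -> exists z, f z = a *: x + y.
Proof. by move=> [z <-] [t <-]; exists (a *: z + t); rewrite linearP. Qed.
Definition lin_image A B (f : {linear A -> B}) : submodule B :=
  Submodule (lin_image0 f) (@lin_image_closed A B f).

Lemma cokernel_exact A B (f : {linear A -> B}) : exact_at f (quotm_proj (lin_image f)).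
Proof.
move=> b; have -> : 0 = quotm_proj (lin_image f) 0 by rewrite raddf0.
by apply: iff_trans; [apply: (quotm_piP (lin_image f))|rewrite subr0].
Qed.

Lemma cokernel_onto A B (f : {linear A -> B}) b : exists a, quotm_proj (lin_image f) a = b.
Proof. exact: quotm_pi_onto. Qed.

Lemma cokernel_exists A B (f : {linear A -> B}) : exists (N : lmodType R) (p : {linear B -> N}),
  exact_at f p /\ forall x, exists y, p y = x.
Proof.
exists (quotm (lin_image f)), (quotm_proj (lin_image f)).
by split; [exact: cokernel_exact|exact: cokernel_onto].
Qed.

Lemma lin_image_factor A B (f : {linear A -> B}) :
  exists f' : {linear A -> subm (lin_image f)},
    (forall x, subm_incl (lin_image f) (f' x) = f x) /\ (forall y, exists x, f' x = y).
Proof.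
have [x|f' ff'] := @linear_cofactor _ _ _ (subm_incl (lin_image f)) f (@subm_incl_inj _ _ _).
  by apply: subm_incl_onto; exists x.
exists f'; split=> // y; have [x fx] := subm_inclP y.
by exists x; apply: (@subm_incl_inj _ _ (lin_image f)); rewrite ff'.
Qed.

Lemma projective_lift P A B D (f : {linear A -> B}) (g : {linear B -> D})
    (h : {linear P -> B}) : projective P -> exact_at f g ->
  (forall x, g (h x) = 0) -> exists h' : {linear P -> A}, forall x, f (h' x) = h x.
Proof.
move=> Pp fg gh; have [f' [ff' f'S]] := lin_image_factor f.
have [x|h1 h1E] := @linear_cofactor _ _ _ (subm_incl (lin_image f)) h (@subm_incl_inj _ _ _).
  by apply: subm_incl_onto; apply/fg.
have [h' h'E] := Pp _ _ f' h1 f'S.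
by exists h' => x; rewrite -ff' h'E h1E.
Qed.

End LinearMaps.

Arguments scale_lin {R A} x.

Section DirectSum.
Variables (R : pzRingType) (J : choiceType) (V : lmodType R).

Definition fin_supp (f : J -> V) := exists l : seq J, forall j, j \notin l -> f j = 0.

Fact fin_supp0 : fin_supp 0. Proof. by exists [::]. Qed.
Fact fin_supp_closed a f g : fin_supp f -> fin_supp g -> fin_supp (a *: f + g).
Proof.
move=> [l lf] [m mg]; exists (l ++ m) => j; rewrite mem_cat negb_or => /andP[jl jm].
by rewrite -[LHS]/(a *: f j + g j) lf // mg // scaler0 addr0.
Qed.
Definition dsum_submodule := Submodule fin_supp0 fin_supp_closed.
Definition dsum := subm dsum_submodule.
HB.instance Definition _ := GRing.Lmodule.on dsum.

Definition dsum_val (s : dsum) : J -> V := subm_incl _ s.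

Fact dsum_pr_linear j : linear (fun s => dsum_val s j).
Proof. by []. Qed.
Definition dsum_pr j : {linear dsum -> V} := mk_linear (dsum_pr_linear j).

Fact dsum_in_supp j v : fin_supp (fun i => if i == j then v else 0).
Proof. by exists [:: j] => i; rewrite inE => /negPf ->. Qed.

Definition dsum_in_fun j v : dsum :=
  @Subm R _ dsum_submodule _ (asboolT (dsum_in_supp j v)).

Lemma dsum_eq (s t : dsum) : (forall j, dsum_pr j s = dsum_pr j t) -> s = t.
Proof. by move=> st; apply: subm_incl_inj; apply/funext => j; apply: st. Qed.

Fact dsum_in_linear j : linear (dsum_in_fun j).
Proof.
move=> a x y; apply: dsum_eq => i; rewrite linearP /= /dsum_val /=.
by case: eqP => _; rewrite ?scaler0 ?addr0.
Qed.
Definition dsum_in j : {linear V -> dsum} := mk_linear (dsum_in_linear j).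

Lemma dsum_pr_in i j v : dsum_pr i (dsum_in j v) = if i == j then v else 0.
Proof. by []. Qed.

Lemma dsum_supp (s : dsum) : exists l : seq J, uniq l /\ forall j, j \notin l -> dsum_pr j s = 0.
Proof.
have [l lP] := subm_inclP s; exists (undup l); split; first exact: undup_uniq.
by move=> j; rewrite mem_undup => /lP.
Qed.

Lemma dsum_decomp (s : dsum) (l : seq J) : uniq l -> (forall j, j \notin l -> dsum_pr j s = 0) ->
  s = \sum_(j <- l) dsum_in j (dsum_pr j s).
Proof.
move=> lU lP; apply: dsum_eq => i; rewrite raddf_sum.
rewrite (eq_bigr (fun j => if i == j then dsum_pr j s else 0)) => [|j _]; last exact: dsum_pr_in.
have [il|il] := boolP (i \in l); last first.
  by rewrite lP // big_seq big1 // => j jl; case: eqP => // ij; rewrite -ij (negPf il) in jl.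
rewrite (bigD1_seq i) //= eqxx big1 ?addr0 // => j /negPf ji.
by rewrite eq_sym ji.
Qed.

Section AdditiveLift.
Variables (N : zmodType) (f : J -> {additive V -> N}).

Definition dsum_supp_of (s : dsum) : seq J := sval (cid (dsum_supp s)).

Definition dsum_lift_fun (s : dsum) : N := \sum_(j <- dsum_supp_of s) f j (dsum_pr j s).

Lemma dsum_lift_funE s l : uniq l -> (forall j, j \notin l -> dsum_pr j s = 0) ->
  dsum_lift_fun s = \sum_(j <- l) f j (dsum_pr j s).
Proof.
have main m : uniq m -> (forall j, j \notin m -> dsum_pr j s = 0) -> forall l : seq J,
    {subset m <= l} -> uniq l ->
    \sum_(j <- m) f j (dsum_pr j s) = \sum_(j <- l) f j (dsum_pr j s).
  move=> mU mP l' ml l'U; rewrite [RHS](bigID (mem m)) /= [X in _ + X]big1 ?addr0; last first.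
    by move=> j jm; rewrite -[dsum_val s j]/(dsum_pr j s) mP ?raddf0.
  rewrite -[RHS]big_filter; apply: perm_big; apply: uniq_perm => //; first exact: filter_uniq.
  by move=> j; rewrite mem_filter /= andb_idr // => /ml.
rewrite /dsum_lift_fun /dsum_supp_of; case: cid => m [mU mP] /= lU lP.
pose k := undup (l ++ m).
rewrite (main m mU mP k) ?(main l lU lP k) ?undup_uniq // => j; rewrite mem_undup mem_cat.
  by move=> ->.
by move=> ->; rewrite orbT.
Qed.

Fact dsum_lift_additive : zmod_morphism dsum_lift_fun.
Proof.
move=> s t; have [l [lU lP]] := dsum_supp s; have [m [mU mP]] := dsum_supp t.
pose k := undup (l ++ m); have kU : uniq k by rewrite undup_uniq.
have k0 j : j \notin k -> dsum_pr j s = 0 /\ dsum_pr j t = 0.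
  by rewrite mem_undup mem_cat negb_or => /andP[jl jm]; rewrite lP // mP.
rewrite !(@dsum_lift_funE _ k) // => [|j /k0[]|j /k0[]|j /k0[s0 t0]] //.
  by rewrite -sumrB; apply: eq_bigr => j _; rewrite linearB raddfB.
by rewrite linearB s0 t0 subr0.
Qed.
Definition dsum_addlift : {additive dsum -> N} := mk_additive dsum_lift_additive.

Lemma dsum_addlift_in j v : dsum_addlift (dsum_in j v) = f j v.
Proof.
rewrite mk_additiveE (@dsum_lift_funE _ [:: j]) // => [|i]; last first.
  by rewrite inE dsum_pr_in => /negPf ->.
by rewrite big_seq1 dsum_pr_in eqxx.
Qed.

End AdditiveLift.

Section LinearLift.
Variables (N : lmodType R) (f : J -> {linear V -> N}).

Fact dsum_lift_linear : linear (dsum_lift_fun (fun j => f j : {additive V -> N})).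
Proof.
move=> a s t; set F := fun j => _.
rewrite -[LHS]/(dsum_addlift F (a *: s + t)) raddfD; congr (_ + _).
have [l [lU lP]] := dsum_supp s; rewrite mk_additiveE !(@dsum_lift_funE _ F _ l) //.
  by rewrite scaler_sumr; apply: eq_bigr => j _; rewrite linearZ_LR /F /= linearZ_LR.
by move=> j /lP s0; rewrite linearZ_LR s0 scaler0.
Qed.
Definition dsum_lift : {linear dsum -> N} := mk_linear dsum_lift_linear.

Lemma dsum_lift_in j v : dsum_lift (dsum_in j v) = f j v.
Proof. by rewrite -[LHS]/(dsum_addlift _ (dsum_in j v)) dsum_addlift_in. Qed.

End LinearLift.

Lemma dsum_ext (N : zmodType) (h h' : {additive dsum -> N}) :
  (forall j v, h (dsum_in j v) = h' (dsum_in j v)) -> forall s, h s = h' s.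
Proof.
move=> hh s; have [l [lU lP]] := dsum_supp s.
by rewrite (dsum_decomp lU lP) !raddf_sum; apply: eq_bigr.
Qed.

End DirectSum.

Section Free.
Variable R : pzRingType.
Implicit Types A B D M N : lmodType R.

Definition free_cover M : {linear dsum M R^o -> M} := dsum_lift (fun x : M => scale_lin x).

Lemma free_cover_onto M (x : M) : exists y, free_cover M y = x.
Proof.
by exists (dsum_in R^o x 1); rewrite /free_cover dsum_lift_in; exact: scale1r.
Qed.

Lemma projective_free (J : choiceType) : projective (dsum J R^o).
Proof.
move=> A B p h pS; have /choice[a ap] : forall j, exists a, p a = h (dsum_in R^o j 1) by [].
exists (dsum_lift (fun j => scale_lin (a j))).
move=> x; apply: (@dsum_ext _ _ _ _ (p \o _) h) => j v; rewrite -[LHS]/(p (dsum_lift _ (dsum_in R^o j v))).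
have E : dsum_in R^o j v = (v : R) *: dsum_in R^o j 1.
  by rewrite -linearZ; congr (dsum_in _ _ _); apply/esym/mulr1.
rewrite dsum_lift_in mk_linearE. rewrite (linearZ_LR p) ap E; exact/esym/(linearZ_LR h).
Qed.

End Free.

(** * Projective resolutions and Ext *)

Section FreeResolution.
Variables (R : pzRingType) (M : lmodType R).

Fixpoint free_syzygy (n : nat) : lmodType R :=
  if n is k.+1 then subm (kernel (free_cover (free_syzygy k))) else M.

Definition free_res (n : nat) : lmodType R := dsum (free_syzygy n) R^o.

Definition free_res_incl n : {linear free_syzygy n.+1 -> free_res n} :=
  subm_incl (kernel (free_cover (free_syzygy n))).

Definition free_res_d n : {linear free_res n.+1 -> free_res n} :=
  free_res_incl n \o free_cover (free_syzygy n.+1).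

Lemma free_resolution :
  projective_resolution free_res_d (free_cover M : {linear free_res 0 -> M}).
Proof.
have ex n : exact_at (free_res_d n) (free_cover (free_syzygy n)).
  move=> b; apply: iff_trans (kernel_exact _ b) _; split=> [[y <-]|[y <-]].
    by have [z <-] := free_cover_onto y; exists z.
  by exists (free_cover (free_syzygy n.+1) y).
split=> [n|x||n b]; [exact: projective_free|exact: free_cover_onto|exact: ex|].
rewrite -(ex n.+1 b) -[free_res_d n b]/(free_res_incl n (free_cover (free_syzygy n.+1) b)).
split=> [H|->]; last exact: raddf0.
by apply: (@subm_incl_inj _ _ (kernel (free_cover (free_syzygy n)))); rewrite [RHS]raddf0.
Qed.

Lemma projective_resolution_exists : exists (P : nat -> lmodType R)
  (d : forall n, {linear P n.+1 -> P n}) (e : {linear P 0%N -> M}), projective_resolution d e.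
Proof. by exists free_res, free_res_d, (free_cover M); exact: free_resolution. Qed.

End FreeResolution.

Lemma exact_at_comp0 (A B D : zmodType) (f : A -> B) (g : B -> D) a :
  exact_at f g -> g (f a) = 0.
Proof. by move=> fg; apply/fg; exists a. Qed.

(** * Ext in degree one, and independence of the resolution *)

Section Ext.
Variable R : pzRingType.
Implicit Types A B D M N P : lmodType R.

Lemma ext1_extend M N A B (f : {linear A -> B}) (g : {linear B -> M}) (h : {linear A -> N}) :
  Ext_eq0 1 M N -> short_exact f g ->
  exists h' : {linear B -> N}, forall a, h' (f a) = h a.
Proof.
move=> E1 [fI fg gS]; have [P [d [e res]]] := projective_resolution_exists M.
have [Pp eS de dd] := res.
have [u0 u0E] := Pp 0%N _ _ g e gS.
have [x|u1 u1E] := projective_lift (h := u0 \o d 0%N) (Pp 1%N) fg.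
  by rewrite /= u0E; apply: exact_at_comp0 de.
have [x|k kE] := E1 _ _ _ res (h \o u1).
  suff E : u1 (d 1%N x) = 0 by rewrite /= E raddf0.
  by apply: fI; rewrite raddf0 u1E /= (exact_at_comp0 _ (dd 0%N)) raddf0.
(* [copair_lin f u0] presents [B] as the quotient of [A * P 0] by the pairs [(- u1 q, d 0 q)], and
   [h + k] kills these because [h \o u1 = k \o d 0]. *)
have [b|[a p]|h' h'E] := @linear_factor _ _ _ _ (copair_lin f u0) (copair_lin h k).
- have [p pb] := eS (g b); have [a ab] : exists a, f a = b - u0 p.
    by apply/fg; rewrite linearB u0E pb subrr.
  by exists (a, p); rewrite mk_linearE /= ab subrK.
- rewrite !mk_linearE /= => E.
  have [q qp] : exists q, d 0%N q = p.
    apply/de; rewrite -u0E; have := congr1 g E.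
    by rewrite linearD raddf0 (exact_at_comp0 _ fg) add0r.
  have aE : a = - u1 q.
    by apply: fI; rewrite linearN u1E /= qp; apply/eqP; rewrite -addr_eq0 E.
  by rewrite aE linearN -[h (u1 q)]/((h \o u1) q) kE qp addNr.
exists h' => a; have := h'E (a, 0).
by rewrite !mk_linearE /= !raddf0 !addr0.
Qed.

Lemma ext1_of_extend M N :
  (forall A B (f : {linear A -> B}) (g : {linear B -> M}) (h : {linear A -> N}),
    short_exact f g -> exists h' : {linear B -> N}, forall a, h' (f a) = h a) ->
  Ext_eq0 1 M N.
Proof.
move=> H P d e [Pp eS de dd] f fd.
have [b|u uE] := @linear_cofactor _ _ _ _ (subm_incl (kernel e)) (d 0%N) (@subm_incl_inj _ _ _).
  by apply: subm_incl_onto; apply: exact_at_comp0 de.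
have [b||h hE] := @linear_factor _ _ _ _ u f.
- have [y yb] := (de (subm_incl _ b)).1 (subm_inclP b); exists y.
  by apply: (@subm_incl_inj _ _ (kernel e)); rewrite uE.
- move=> a ua; have [y <-] : exists y, d 1%N y = a by apply/dd; rewrite -uE ua raddf0.
  exact: fd.
have [|h' h'E] := H _ _ (subm_incl (kernel e)) e h.
  split=> //; [exact: subm_incl_inj|exact: kernel_exact].
by exists h' => x; rewrite -hE -h'E uE.
Qed.

Lemma ext1_of_split M N :
  (forall B (f : {linear N -> B}) (g : {linear B -> M}), short_exact f g ->
    exists r : {linear B -> N}, forall x, r (f x) = x) ->
  Ext_eq0 1 M N.
Proof.
move=> H; apply: ext1_of_extend => A B f g h [fI fg gS].
(* The cokernel of [k] is the pushout of [f] along [h], an extension of [M] by [N]; a retraction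
   onto [N] composed with the map from [B] extends [h]. *)
pose k : {linear A -> (N * B)%type} := pair_lin h (\- f : {linear A -> B}).
have kx := @cokernel_exact _ _ _ k; have pS := @cokernel_onto _ _ _ k.
set p := quotm_proj _ in kx pS.
pose g' : {linear (N * B)%type -> M} := copair_lin \0 g.
have g'E y : g' y = g y.2 by rewrite mk_linearE /= add0r.
have [//|y py|t tE] := @linear_factor _ _ _ _ p g'.
  by have [a <-] := (kx y).1 py; rewrite g'E /= linearN (exact_at_comp0 _ fg) oppr0.
have [j jE] : exists j : {linear N -> quotm (lin_image k)}, forall x, j x = p (x, 0).
  by exists (p \o pair_lin idfun \0).
have [|r rE] := H _ j t.
  split=> [|b|m].
  - apply: linear_eq0 => x; rewrite jE => /kx[a] /= [<- /eqP].
    by rewrite oppr_eq0 => /eqP E; rewrite (fI a 0) ?raddf0 // E raddf0.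
  - split=> [|[a <-]]; last by rewrite jE tE g'E /= raddf0.
    have [[x b'] <-] := pS b; rewrite tE g'E /= => /fg[a ab].
    exists (x + h a); rewrite jE; apply/eqP; rewrite -subr_eq0 -linearB; apply/eqP/kx.
    by exists a; congr (_, _) => /=; rewrite ?sub0r ?ab // addrAC subrr add0r.
  - by have [b bm] := gS m; exists (p (0, b)); rewrite tE g'E.
have [q qE] : exists q : {linear B -> quotm (lin_image k)}, forall b, q b = p (0, b).
  by exists (p \o pair_lin \0 idfun).
exists (r \o q) => a /=; rewrite qE.
rewrite -[RHS]rE jE; congr (r _); apply/eqP; rewrite -subr_eq0 -linearB; apply/eqP/kx.
exists (- a); congr (_, _) => /=; rewrite ?linearN ?opprK ?sub0r ?subr0 //.
Qed.

Section Comparison.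
Variables (M : lmodType R) (P P' : nat -> lmodType R).
Variables (d : forall n, {linear P n.+1 -> P n}) (e : {linear P 0%N -> M}).
Variables (d' : forall n, {linear P' n.+1 -> P' n}) (e' : {linear P' 0%N -> M}).

Lemma resolution_map : projective_resolution d e -> projective_resolution d' e' ->
  exists u : forall n, {linear P n -> P' n},
    (forall x, e' (u 0%N x) = e x) /\ forall n x, d' n (u n.+1 x) = u n (d n x).
Proof.
move=> [Pp eS de dd] [_ e'S de' dd'].
have [u0 u0E] := Pp 0%N _ _ e' e e'S.
have [x|u1 u1E] := projective_lift (h := u0 \o d 0%N) (Pp 1%N) de'.
  by rewrite /= u0E; apply: exact_at_comp0 de.
(* The state holds two consecutive maps and their commutation: the next lift exists because the
   square below it commutes. *)
pose st n := {u : {linear P n -> P' n} * {linear P n.+1 -> P' n.+1} |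
  forall x, d' n (u.2 x) = u.1 (d n x)}.
have step n (s : st n) : {v : {linear P n.+2 -> P' n.+2} |
    forall x, d' n.+1 (v x) = (sval s).2 (d n.+1 x)}.
  apply: cid; apply: (projective_lift (h := (sval s).2 \o d n.+1) (Pp n.+2) (dd' n)) => x.
  by rewrite /= (svalP s) (exact_at_comp0 _ (dd n)) raddf0.
pose s0 : st 0%N := exist _ (u0, u1) u1E.
pose sS n (s : st n) : st n.+1 := exist _ ((sval s).2, sval (step n s)) (svalP (step n s)).
pose s := fix s n : st n := if n is k.+1 then sS k (s k) else s0.
by exists (fun n => (sval (s n)).1); split=> // n x; exact: (svalP (s n)).
Qed.

End Comparison.

Lemma resolution_homotopy M (P : nat -> lmodType R) (d : forall n, {linear P n.+1 -> P n})
    (e : {linear P 0%N -> M}) (w : forall n, {linear P n -> P n}) :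
  projective_resolution d e -> (forall x, e (w 0%N x) = 0) ->
  (forall n x, d n (w n.+1 x) = w n (d n x)) ->
  exists s : forall n, {linear P n -> P n.+1},
    forall n x, w n.+1 x = d n.+1 (s n.+1 x) + s n (d n x).
Proof.
move=> [Pp eS de dd] ew dw.
have [s0 s0E] := projective_lift (Pp 0%N) de ew.
have [x|s1 s1E] := projective_lift (h := w 1%N \- (s0 \o d 0%N) : {linear _ -> _}) (Pp 1%N) (dd 0%N).
  by rewrite /= linearB dw s0E subrr.
pose st n := {s : {linear P n -> P n.+1} * {linear P n.+1 -> P n.+2} |
  forall x, d n.+1 (s.2 x) = w n.+1 x - s.1 (d n x)}.
have step n (s : st n) : {t : {linear P n.+2 -> P n.+3} |
    forall x, d n.+2 (t x) = w n.+2 x - (sval s).2 (d n.+1 x)}.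
  apply: cid; have [x|t tE] := projective_lift
    (h := w n.+2 \- ((sval s).2 \o d n.+1) : {linear _ -> _}) (Pp n.+2) (dd n.+1); last by exists t.
  by rewrite /= linearB dw (svalP s) (exact_at_comp0 _ (dd n)) raddf0 subr0 subrr.
pose t0 : st 0%N := exist _ (s0, s1) s1E.
pose tS n (s : st n) : st n.+1 := exist _ ((sval s).2, sval (step n s)) (svalP (step n s)).
pose t := fix t n : st n := if n is k.+1 then tS k (t k) else t0.
exists (fun n => (sval (t n)).1) => n x.
by have := svalP (t n) x => /= ->; rewrite subrK.
Qed.

(** [Ext_eq0] quantifies over all resolutions; with this it can be checked on a single one, such as
    the degreewise finite resolution of [C]. *)
Lemma ext_independent M N (P P' : nat -> lmodType R)
    (d : forall n, {linear P n.+1 -> P n}) (e : {linear P 0%N -> M})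
    (d' : forall n, {linear P' n.+1 -> P' n}) (e' : {linear P' 0%N -> M}) j :
  projective_resolution d e -> projective_resolution d' e' ->
  (forall f : {linear P j.+1 -> N}, (forall x, f (d j.+1 x) = 0) ->
      exists g : {linear P j -> N}, forall x, f x = g (d j x)) ->
  forall f : {linear P' j.+1 -> N}, (forall x, f (d' j.+1 x) = 0) ->
      exists g : {linear P' j -> N}, forall x, f x = g (d' j x).
Proof.
move=> res res' H f fd'.
have [u [u0 uE]] := resolution_map res res'; have [v [v0 vE]] := resolution_map res' res.
have [||s sE] := resolution_homotopy (w := fun n => idfun \- (u n \o v n) : {linear _ -> _}) res'.
- by move=> x /=; rewrite linearB u0 v0 subrr.
- by move=> n x /=; rewrite linearB uE vE.
have [x|g gE] := H (f \o u j.+1).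
  by rewrite /= -uE fd'.
exists ((g \o v j) \+ (f \o s j) : {linear _ -> _}) => x /=.
have := congr1 f (sE j x); rewrite /= linearB linearD fd' add0r => <-.
by rewrite -vE -gE /= addrC subrK.
Qed.

End Ext.

(** * Character modules and tensor products *)

Section Dual.
Variables (R : pzRingType) (Y : lmodType R^c).

(** For a right module [Y], [chr Y] is a module over [R^c^c]; [dual Y] is the same group as a left
    module over [R] itself. *)
Definition dual : Type := {additive Y -> QmodZ}.
HB.instance Definition _ := GRing.Zmodule.copy dual (chr Y).

Implicit Types (f g : dual) (r : R).

Lemma dualP f g : (forall y, f y = g y) <-> f = g.
Proof. exact: (@chrP R^c Y f g). Qed.

Definition dual_scale r f : dual := f \o *:%R (r : R^c).

Let scaleA a b f : dual_scale a (dual_scale b f) = dual_scale (a * b) f.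
Proof. by apply/dualP => x /=; rewrite scalerA. Qed.
Let scale1 : left_id 1 dual_scale.
Proof. by move=> f; apply/dualP => x /=; rewrite scale1r. Qed.
Let scaleDr : right_distributive dual_scale +%R.
Proof. by move=> a f g; apply/dualP. Qed.
Let scaleDl f : {morph dual_scale^~ f : a b / a + b}.
Proof. by move=> a b; apply/dualP => x /=; rewrite scalerDl raddfD. Qed.

HB.instance Definition _ :=
  GRing.Zmodule_isLmodule.Build R dual scaleA scale1 scaleDr scaleDl.

End Dual.

Fact chr_map_linear (R : pzRingType) (A B : lmodType R) (f : {linear A -> B}) :
  linear (fun h : chr B => h \o f : chr A).
Proof. by move=> a x y; apply/chrP => z; rewrite /= [in RHS]linearZ_LR. Qed.
Definition chr_map (R : pzRingType) (A B : lmodType R) (f : {linear A -> B}) :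
  {linear chr B -> chr A} := mk_linear (chr_map_linear f).

Fact dual_map_linear (R : pzRingType) (A B : lmodType R^c) (f : {linear A -> B}) :
  linear (fun h : dual B => h \o f : dual A).
Proof. by move=> a x y; apply/dualP => z; rewrite /= [in RHS]linearZ_LR. Qed.
Definition dual_map (R : pzRingType) (A B : lmodType R^c) (f : {linear A -> B}) :
  {linear dual B -> dual A} := mk_linear (dual_map_linear f).

Lemma chr_exact (R : pzRingType) (A B D : lmodType R) (f : {linear A -> B}) (g : {linear B -> D}) :
  exact_at f g -> exact_at (chr_map g) (chr_map f).
Proof.
move=> /exact_coexact fg phi; have [H1 H2] := fg phi; split=> [phif|[psi psiE]].
  have [|psi psiE] := H1; first by move=> a; have /chrP/(_ a) := phif.
  by exists psi; apply/chrP => b; rewrite psiE.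
by apply/chrP => a; apply: H2; exists psi => b; rewrite -psiE.
Qed.

HB.instance Definition _ (R : pzRingType) (Y Y' : lmodType R^c) (M M' : lmodType R)
  (f : {linear Y -> Y'}) (g : {linear M -> M'}) :=
  GRing.isZmodMorphism.Build _ _ (tmap f g) (tmap_is_additive f g).
HB.instance Definition _ (R : pzRingType) (Y : lmodType R^c) (M M' : lmodType R)
  (g : {linear M -> M'}) :=
  GRing.isZmodMorphism.Build _ _ (ltens Y g) (tmap_is_additive idfun g).

Definition rtens (R : pzRingType) (Y Y' : lmodType R^c) (f : {linear Y -> Y'}) (M : lmodType R) :
  tens Y M -> tens Y' M := tmap f (idfun : {linear M -> M}).
Arguments rtens {R Y Y'} f M.
HB.instance Definition _ (R : pzRingType) (Y Y' : lmodType R^c) (f : {linear Y -> Y'}) (M : lmodType R) :=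
  GRing.isZmodMorphism.Build _ _ (rtens f M) (tmap_is_additive f idfun).

Section TensorTheory.
Variable R : pzRingType.
Implicit Types (X Y Z : lmodType R^c) (M N P A B D : lmodType R).

Lemma ltensE Y M N (g : {linear M -> N}) y x : ltens Y g (tmul y x) = tmul y (g x).
Proof. exact: tmapE. Qed.

Lemma rtensE Y Z (f : {linear Y -> Z}) M y x : rtens f M (tmul y x) = tmul (f y) x.
Proof. exact: tmapE. Qed.

Lemma tmul0r Y M (x : M) : tmul (0 : Y) x = 0.
Proof.
have [mDl _ _] := tmul_balanced Y M.
by apply: (addIr (tmul 0 x)); rewrite -mDl !add0r.
Qed.

Lemma tmulr0 Y M (y : Y) : tmul y (0 : M) = 0.
Proof.
have [_ mDr _] := tmul_balanced Y M.
by apply: (addIr (tmul y 0)); rewrite -mDr !add0r.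
Qed.

Lemma tens_ext Y M (G : zmodType) (f g : {additive tens Y M -> G}) :
  (forall y x, f (tmul y x) = g (tmul y x)) -> forall t, f t = g t.
Proof.
move=> fg; apply: tens_ind => //; first by rewrite !raddf0.
- by move=> t u ft fu; rewrite !raddfD ft fu.
- by move=> t ft; rewrite !raddfN ft.
Qed.

Lemma tlift_exists Y M (G : zmodType) (b : Y -> M -> G) : balanced b ->
  exists f : {additive tens Y M -> G}, forall y x, f (tmul y x) = b y x.
Proof.
move=> bb; exists (mk_additive (tlift_is_additive bb)) => y x.
by rewrite mk_additiveE tliftE.
Qed.

(** This and the next three lemmas are the two adjunctions, identifying the characters of [Y (x) M]
    with Hom(Y, M^+) and with Hom(M, Y^+). *)
Lemma tens_chr Y M (phi : {additive tens Y M -> QmodZ}) :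
  exists L : {linear Y -> chr M}, forall y x, L y x = phi (tmul y x).
Proof.
have [mDl mDr mZ] := tmul_balanced Y M.
have ad y : zmod_morphism (fun x => phi (tmul y x)).
  move=> x x'; rewrite -raddfB; congr (phi _); apply: (addIr (tmul y x')).
  by rewrite -mDr !subrK.
have lin : linear (fun y => mk_additive (ad y) : chr M).
  move=> a y y'; apply/chrP => x.
  by rewrite -[RHS]/(phi (tmul y ((a : R) *: x)) + phi (tmul y' x)) /= -raddfD mDl mZ.
by exists (mk_linear lin).
Qed.

Lemma chr_tens Y M (L : {linear Y -> chr M}) :
  exists phi : {additive tens Y M -> QmodZ}, forall y x, phi (tmul y x) = L y x.
Proof.
apply: tlift_exists; split=> [y y' x|y x x'|r y x].
- by rewrite linearD.
- exact: raddfD.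
- by rewrite linearZ_LR.
Qed.

Lemma tens_dual Y M (phi : {additive tens Y M -> QmodZ}) :
  exists L : {linear M -> dual Y}, forall y x, L x y = phi (tmul y x).
Proof.
have [mDl mDr mZ] := tmul_balanced Y M.
have ad x : zmod_morphism (fun y => phi (tmul y x)).
  move=> y y'; rewrite -raddfB; congr (phi _); apply: (addIr (tmul y' x)).
  by rewrite -mDl !subrK.
have lin : linear (fun x => mk_additive (ad x) : dual Y).
  move=> a x x'; apply/dualP => y.
  by rewrite -[RHS]/(phi (tmul ((a : R^c) *: y) x) + phi (tmul y x')) /= -raddfD mDr mZ.
by exists (mk_linear lin).
Qed.

Lemma dual_tens Y M (L : {linear M -> dual Y}) :
  exists phi : {additive tens Y M -> QmodZ}, forall y x, phi (tmul y x) = L x y.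
Proof.
apply: tlift_exists; split=> [y y' x|y x x'|r y x].
- exact: raddfD.
- by rewrite linearD.
- by rewrite linearZ_LR.
Qed.

Lemma tens_surjective Y Z M N (f : {linear Y -> Z}) (g : {linear M -> N}) :
  (forall z, exists y, f y = z) -> (forall z, exists x, g x = z) ->
  forall t, exists s, tmap f g s = t.
Proof.
move=> fS gS; apply: tens_ind => [|t u [s <-] [r <-]|t [s <-]|y x].
- by exists 0; rewrite raddf0.
- by exists (s + r); rewrite raddfD.
- by exists (- s); rewrite raddfN.
- by have [y' <-] := fS y; have [x' <-] := gS x; exists (tmul y' x'); rewrite tmapE.
Qed.

Lemma ltens_right_exact Y A B D (f : {linear A -> B}) (g : {linear B -> D}) :
  exact_at f g -> (forall z, exists x, g x = z) -> exact_at (ltens Y f) (ltens Y g).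
Proof.
move=> fg gS; apply/exact_coexact => phi; split=> [phif|[psi psiE] a]; last first.
  rewrite psiE -[RHS](raddf0 psi); congr (psi _).
  apply: (@tens_ext Y A _ (ltens Y g \o ltens Y f) \0) a => y x /=.
  by rewrite !ltensE (exact_at_comp0 _ fg) tmulr0.
have [L LE] := tens_dual phi.
have [//|b /fg[a <-]|L' L'E] := @linear_factor _ _ _ _ g L.
  by apply/dualP => y; rewrite LE -ltensE phif.
have [psi psiE] := dual_tens L'; exists psi.
by apply: (@tens_ext Y B _ phi (psi \o ltens Y g)) => y x /=; rewrite ltensE psiE L'E LE.
Qed.

Lemma rtens_right_exact Y Z X M (f : {linear Y -> Z}) (g : {linear Z -> X}) :
  exact_at f g -> (forall z, exists x, g x = z) -> exact_at (rtens f M) (rtens g M).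
Proof.
move=> fg gS; apply/exact_coexact => phi; split=> [phif|[psi psiE] a]; last first.
  rewrite psiE -[RHS](raddf0 psi); congr (psi _).
  apply: (@tens_ext Y M _ (rtens g M \o rtens f M) \0) a => y x /=.
  by rewrite !rtensE (exact_at_comp0 _ fg) tmul0r.
have [L LE] := tens_chr phi.
have [//|b /fg[a <-]|L' L'E] := @linear_factor _ _ _ _ g L.
  by apply/chrP => x; rewrite LE -rtensE phif.
have [psi psiE] := chr_tens L'; exists psi.
by apply: (@tens_ext Z M _ phi (psi \o rtens g M)) => y x /=; rewrite rtensE psiE L'E LE.
Qed.

Lemma rtens_comp Y Z X M (f : {linear Y -> Z}) (g : {linear Z -> X})
    (h : {linear Y -> X}) :
  (forall y, g (f y) = h y) -> forall t, rtens g M (rtens f M t) = rtens h M t.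
Proof.
move=> gf; apply: (@tens_ext _ _ _ (rtens g M \o rtens f M) (rtens h M)) => y x /=.
by rewrite !rtensE gf.
Qed.

Lemma ltens_comp Y A B D (f : {linear A -> B}) (g : {linear B -> D})
    (h : {linear A -> D}) :
  (forall x, g (f x) = h x) -> forall t, ltens Y g (ltens Y f t) = ltens Y h t.
Proof.
move=> gf; apply: (@tens_ext _ _ _ (ltens Y g \o ltens Y f) (ltens Y h)) => y x /=.
by rewrite !ltensE gf.
Qed.

Lemma ltens_comp0 Y A B D (f : {linear A -> B}) (g : {linear B -> D}) t :
  (forall x, g (f x) = 0) -> ltens Y g (ltens Y f t) = 0.
Proof.
move=> gf; rewrite (@ltens_comp _ _ _ _ _ _ \0) //.
by apply: (@tens_ext _ _ _ (ltens Y \0) \0) => y x; rewrite [LHS]ltensE tmulr0.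
Qed.

Lemma rtens_ltens Y Z M N (f : {linear Y -> Z}) (g : {linear M -> N}) t :
  rtens f N (ltens Y g t) = ltens Z g (rtens f M t).
Proof.
apply: (@tens_ext _ _ _ (rtens f N \o ltens Y g) (ltens Z g \o rtens f M)) => y x /=.
by rewrite ltensE !rtensE ltensE.
Qed.

Lemma flat_exact P Y Z X (f : {linear Y -> Z}) (g : {linear Z -> X}) :
  flat P -> exact_at f g -> exact_at (rtens f P) (rtens g P).
Proof.
move=> Pf fg; have [g' [gg' g'S]] := lin_image_factor g.
have fg' : exact_at f g'.
  move=> b; rewrite -(fg b) -gg'; split=> [->|]; first by rewrite raddf0.
  by rewrite -(raddf0 (subm_incl (lin_image g))) => /subm_incl_inj.
have R' := @rtens_right_exact _ _ _ P _ _ fg' g'S; move=> t; apply: iff_trans (R' t).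
rewrite -(rtens_comp gg'); split=> [|->]; last by rewrite raddf0.
by rewrite -(raddf0 (rtens (subm_incl (lin_image g)) P)) => /(Pf _ _ _ (@subm_incl_inj _ _ _)).
Qed.

(** For injective [f] the map [dual_map f] is surjective, so linear maps from [P] lift along it; by
    adjunction, characters then extend along [rtens f P]. *)
Lemma projective_flat P : projective P -> flat P.
Proof.
move=> Pp Y Z f fI; apply/(character_injective (rtens f P)) => phi.
have [L LE] := tens_dual phi.
have [h|L' L'E] := Pp _ _ (dual_map f) L.
  have /character_injective/(_ h)[h' h'E] := fI.
  by exists h'; apply/dualP.
have [psi psiE] := dual_tens L'; exists psi.
apply: (@tens_ext _ _ _ (psi \o rtens f P) phi) => y x /=.
by rewrite rtensE psiE -LE -L'E.
Qed.

Lemma projective_ltens_exact (Q : lmodType R^c) A B D (f : {linear A -> B}) (g : {linear B -> D}) :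
  projective Q -> exact_at f g -> exact_at (ltens Q f) (ltens Q g).
Proof.
move=> Qp fg; apply/exact_coexact => phi; split=> [phif|[psi psiE] a]; last first.
  rewrite psiE -[RHS](raddf0 psi); congr (psi _).
  apply: (@tens_ext Q A _ (ltens Q g \o ltens Q f) \0) a => y x /=.
  by rewrite !ltensE (exact_at_comp0 _ fg) tmulr0.
have [L LE] := tens_chr phi.
have [x|L' L'E] := projective_lift (h := L) Qp (chr_exact fg).
  by apply/chrP => y; rewrite -[LHS]/(L x (f y)) LE -ltensE phif.
have [psi psiE] := chr_tens L'; exists psi.
apply: (@tens_ext _ _ _ phi (psi \o ltens Q g)) => y x /=.
by rewrite ltensE psiE -LE -L'E.
Qed.

End TensorTheory.

(** * Balancing Tor *)

Section DoubleComplex.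
Variables (D : nat -> nat -> zmodType) (A B : nat -> zmodType).
Variables (h : forall k j, {additive D k.+1 j -> D k j}).
Variables (v : forall k j, {additive D k j.+1 -> D k j}).
Variables (eps : forall j, {additive D 0%N j -> A j}).
Variables (aug : forall k, {additive D k 0%N -> B k}).
Variables (dA : forall j, {additive A j.+1 -> A j}) (dB : forall k, {additive B k.+1 -> B k}).
Hypothesis hv : forall k j x, h k j (v k.+1 j x) = v k j (h k j.+1 x).
Hypothesis eps_v : forall j x, eps j (v 0%N j x) = dA j (eps j.+1 x).
Hypothesis aug_h : forall k x, aug k (h k 0%N x) = dB k (aug k.+1 x).
Hypothesis rows : forall j, [/\ forall a, exists x, eps j x = a,
  exact_at (h 0%N j) (eps j) & forall k, exact_at (h k.+1 j) (h k j)].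
Hypothesis cols : forall k, [/\ forall b, exists x, aug k x = b,
  exact_at (v k 0%N) (aug k) & forall j, exact_at (v k j.+1) (v k j)].

(* A staircase argument: solving the problem in bidegree (k.+1, m.+1) only     *)
(* needs the solution one step down the anti-diagonal, in (k.+2, m).           *)
Lemma double_complex_chase : (forall k, exact_at (dB k.+1) (dB k)) ->
  forall m k (x : D k.+1 m),
    match m return D k.+1 m -> Prop with
    | 0 => fun x => dB k (aug k.+1 x) = 0
    | m'.+1 => fun x => h k m' (v k.+1 m' x) = 0
    end x ->
    exists y z, x = h k.+1 m y + v k.+1 m z.
Proof.
move=> exB; elim=> [|m IH] k x.
  move=> /exB[b bx]; have [aS av _] := cols k.+2; have [y yb] := aS b.
  have [_ av' _] := cols k.+1.
  have [z zE] : exists z, v k.+1 0%N z = x - h k.+1 0%N y.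
    by apply/av'; rewrite raddfB aug_h yb bx subrr.
  by exists y, z; rewrite zE addrC subrK.
have [_ _ hh] := rows m => /hh[x' x'E].
have [|y [z yz]] := IH _ x'.
  case: m IH x hh x' x'E => [|m] IH x hh x' x'E.
    have [_ av _] := cols k.+1.
    by rewrite -aug_h x'E (exact_at_comp0 _ av).
  have [_ _ vv] := cols k.+1.
  by rewrite hv x'E (exact_at_comp0 _ (vv m)).
have [_ _ vv] := cols k.+1.
have [w wE] : exists w, v k.+1 m.+1 w = x - h k.+1 m.+1 z.
  apply/vv; rewrite raddfB -hv -x'E yz raddfD (exact_at_comp0 _ (hh _)) add0r.
  by rewrite subrr.
by exists z, w; rewrite wE addrC subrK.
Qed.

(** Used on a double complex and on its transpose, this gives the two directions of
    [tor_balance]. *)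
Lemma double_complex_exact : (forall k, exact_at (dB k.+1) (dB k)) ->
  forall j, exact_at (dA j.+1) (dA j).
Proof.
move=> exB j a; have [eS' _ _] := rows j.+2.
have [_ _ vv] := cols 0%N.
split=> [da|[a' <-]]; last first.
  have [x <-] := eS' a'.
  by rewrite -!eps_v (exact_at_comp0 _ (vv j)) raddf0.
have [eS he _] := rows j.+1; have [x xa] := eS a.
have [_ he' hh] := rows j.
have [x' x'E] : exists x', h 0%N j x' = v 0%N j x.
  by apply/he'; rewrite eps_v xa.
have [|y [z yz]] := double_complex_chase exB (x := x').
  case: j a da eS' eS he x xa he' hh x' x'E => [|j] a da eS' eS he x xa he' hh x' x'E.
    by have [_ av _] := cols 0%N; rewrite -aug_h x'E (exact_at_comp0 _ av).
  by rewrite hv x'E (exact_at_comp0 _ (vv j)).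
have [w wE] : exists w, v 0%N j.+1 w = x - h 0%N j.+1 z.
  by apply/vv; rewrite raddfB -hv -x'E yz raddfD (exact_at_comp0 _ (hh _)) add0r subrr.
exists (eps j.+2 w); rewrite -eps_v wE raddfB xa (exact_at_comp0 _ he) subr0 //.
Qed.

End DoubleComplex.

(** Flatness is all that balancing asks of the resolution of [M]. The left half of the complex of a
    G_C-flat module is flat but not necessarily projective. *)
Definition flat_resolution (R : pzRingType) (M : lmodType R) (P : nat -> lmodType R)
    (d : forall n, {linear P n.+1 -> P n}) (e : {linear P 0%N -> M}) :=
  [/\ forall n, flat (P n),
      forall x, exists y, e y = x,
      exact_at (d 0%N) e
    & forall n, exact_at (d n.+1) (d n)].

Lemma projective_flat_resolution (R : pzRingType) (M : lmodType R) (P : nat -> lmodType R)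
    (d : forall n, {linear P n.+1 -> P n}) (e : {linear P 0%N -> M}) :
  projective_resolution d e -> flat_resolution d e.
Proof. by case=> Pp *; split=> // n; apply: projective_flat. Qed.

Section Balance.
Variables (R : pzRingType) (Y : lmodType R^c) (M : lmodType R).
Variables (Q : nat -> lmodType R^c) (q : forall n, {linear Q n.+1 -> Q n}) (c : {linear Q 0%N -> Y}).
Variables (P : nat -> lmodType R) (d : forall n, {linear P n.+1 -> P n}) (e : {linear P 0%N -> M}).
Hypotheses (Qres : projective_resolution q c) (Pres : flat_resolution d e).

Let rows j : [/\ forall a, exists x, rtens c (P j) x = a,
  exact_at (rtens (q 0%N) (P j)) (rtens c (P j)) &
  forall k, exact_at (rtens (q k.+1) (P j)) (rtens (q k) (P j))].
Proof.
case: Qres Pres => [_ cS qc qq] [Pf _ _ _]; split.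
- by apply: tens_surjective => // z; exists z.
- exact: flat_exact.
- by move=> k; apply: flat_exact.
Qed.

Let cols k : [/\ forall b, exists x, ltens (Q k) e x = b,
  exact_at (ltens (Q k) (d 0%N)) (ltens (Q k) e) &
  forall j, exact_at (ltens (Q k) (d j.+1)) (ltens (Q k) (d j))].
Proof.
case: Qres Pres => [Qp _ _ _] [_ eS de dd]; split.
- by apply: tens_surjective => // z; exists z.
- exact: projective_ltens_exact.
- by move=> j; apply: projective_ltens_exact.
Qed.

(** In the double complex with entries [Q k (x) P j], flatness of the [P j] makes one direction
    exact and projectivity of the [Q k] the other. *)
Lemma tor_balance :
  (forall j, exact_at (ltens Y (d j.+1)) (ltens Y (d j))) <->
  (forall k, exact_at (rtens (q k.+1) M) (rtens (q k) M)).
Proof.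
split.
  apply: (@double_complex_exact (fun j k => tens (Q k) (P j))
    (fun k => tens (Q k) M) (fun j => tens Y (P j))
    (fun j k => ltens (Q k) (d j)) (fun j k => rtens (q k) (P j))
    (fun k => ltens (Q k) e) (fun j => rtens c (P j))
    (fun k => rtens (q k) M) (fun j => ltens Y (d j))) => //.
  - by move=> k j x; apply/esym/rtens_ltens.
  - by move=> k x; apply/esym/rtens_ltens.
  - by move=> k x; apply: rtens_ltens.
apply: (@double_complex_exact (fun k j => tens (Q k) (P j))
    (fun j => tens Y (P j)) (fun k => tens (Q k) M) 
    (fun k j => rtens (q k) (P j)) (fun k j => ltens (Q k) (d j))
    (fun j => rtens c (P j)) (fun k => ltens (Q k) e)
    (fun j => ltens Y (d j)) (fun k => rtens (q k) M)) => //.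
- by move=> k j x; apply: rtens_ltens.
- by move=> k x; apply: rtens_ltens.
- by move=> k x; apply/esym/rtens_ltens.
Qed.

End Balance.

(** * Tor read as Ext into character modules *)

Section TorExt.
Variable R : pzRingType.
Implicit Types (Y : lmodType R^c) (M N A B D : lmodType R).

Lemma exact_rtens_chr Y (Q Q' : lmodType R^c) M (f : {linear Q -> Q'}) (g : {linear Q' -> Y}) :
  exact_at (rtens f M) (rtens g M) <->
  forall h : {linear Q' -> chr M}, (forall x, h (f x) = 0) <->
    exists k : {linear Y -> chr M}, forall x, h x = k (g x).
Proof.
split=> [/exact_coexact H h|H].
  have [phi phiE] := chr_tens h; have [H1 H2] := H phi; split=> [hf|[k kE] x].
    have [|psi psiE] := H1.
      apply: (@tens_ext _ _ _ _ (phi \o rtens f M) \0) => y x /=.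
      by rewrite rtensE phiE hf.
    have [k kE] := tens_chr psi; exists k => x; apply/chrP => y.
    by rewrite kE -rtensE -psiE phiE.
  have [psi psiE] := chr_tens k.
  have {}H2 := H2 _; apply/chrP => y.
  rewrite -phiE -rtensE H2 //; exists psi.
  apply: (@tens_ext _ _ _ _ phi (psi \o rtens g M)) => z t /=. by rewrite rtensE phiE kE psiE.
apply/exact_coexact => phi; have [h hE] := tens_chr phi; have [H1 H2] := H h.
split=> [phif|[psi psiE]].
  have [|k kE] := H1.
    by move=> x; apply/chrP => y; rewrite hE -rtensE phif.
  have [psi psiE] := chr_tens k; exists psi.
  by apply: (@tens_ext _ _ _ _ phi (psi \o rtens g M)) => y x /=; rewrite rtensE psiE -kE hE.
have [k kE] := tens_chr psi; apply: (@tens_ext _ _ _ _ (phi \o rtens f M) \0) => y x /=.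
rewrite rtensE -hE H2 //; exists k => z; apply/chrP => t.
by rewrite hE kE psiE /= rtensE.
Qed.

Lemma exact_ltens_dual Y (A B D : lmodType R) (f : {linear A -> B}) (g : {linear B -> D}) :
  exact_at (ltens Y f) (ltens Y g) <->
  forall h : {linear B -> dual Y}, (forall x, h (f x) = 0) <->
    exists k : {linear D -> dual Y}, forall x, h x = k (g x).
Proof.
split=> [/exact_coexact H h|H].
  have [phi phiE] := dual_tens h; have [H1 H2] := H phi; split=> [hf|[k kE] x].
    have [|psi psiE] := H1.
      apply: (@tens_ext _ _ _ _ (phi \o ltens Y f) \0) => y x /=.
      by rewrite ltensE phiE hf.
    have [k kE] := tens_dual psi; exists k => x; apply/dualP => y.
    by rewrite kE -ltensE -psiE phiE.
  have [psi psiE] := dual_tens k.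
  have {}H2 := H2 _; apply/dualP => y.
  rewrite -phiE -ltensE H2 //; exists psi.
  by apply: (@tens_ext _ _ _ _ phi (psi \o ltens Y g)) => z t /=; rewrite ltensE phiE kE psiE.
apply/exact_coexact => phi; have [h hE] := tens_dual phi; have [H1 H2] := H h.
split=> [phif|[psi psiE]].
  have [|k kE] := H1.
    by move=> x; apply/dualP => y; rewrite hE -ltensE phif.
  have [psi psiE] := dual_tens k; exists psi.
  by apply: (@tens_ext _ _ _ _ phi (psi \o ltens Y g)) => y x /=; rewrite ltensE psiE -kE hE.
have [k kE] := tens_dual psi; apply: (@tens_ext _ _ _ _ (phi \o ltens Y f) \0) => y x /=.
rewrite ltensE -hE H2 //; exists k => z; apply/dualP => t.
by rewrite hE kE psiE /= ltensE.
Qed.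

(* Phrased through Ext over [R^c], since [Y] rather than [M] is resolved.       *)
Definition tor_acyclic Y M := forall i, (1 <= i)%N -> Ext_eq0 (R := R^c) i Y (chr M).

Lemma resolution_complex M (P : nat -> lmodType R) (d : forall n, {linear P n.+1 -> P n})
    (e : {linear P 0%N -> M}) n x : projective_resolution d e -> d n (d n.+1 x) = 0.
Proof. by case=> _ _ _ dd; exact: exact_at_comp0 (dd n). Qed.

End TorExt.

Section TorAcyclic.
Variables (R : pzRingType) (Y : lmodType R^c) (M : lmodType R).

Lemma tor_acyclic_rtens (Q : nat -> lmodType R^c) (q : forall n, {linear Q n.+1 -> Q n})
    (c : {linear Q 0%N -> Y}) : projective_resolution q c -> tor_acyclic Y M ->
  forall k, exact_at (rtens (q k.+1) M) (rtens (q k) M).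
Proof.
move=> res H k; apply/exact_rtens_chr => h; split=> [|[g gE] x]; last first.
  by rewrite gE (resolution_complex _ res) raddf0.
exact: (H k.+1 isT _ _ _ res).
Qed.

Lemma rtens_tor_acyclic :
  (forall (Q : nat -> lmodType R^c) (q : forall n, {linear Q n.+1 -> Q n})
    (c : {linear Q 0%N -> Y}), projective_resolution q c ->
    forall k, exact_at (rtens (q k.+1) M) (rtens (q k) M)) -> tor_acyclic Y M.
Proof.
move=> H [//|k] _ Q q c res; move=> h; exact: ((exact_rtens_chr _ _ _).1 (H Q q c res k) h).1.
Qed.

Lemma flat_res_tor_acyclic (P : nat -> lmodType R) (d : forall n, {linear P n.+1 -> P n})
    (e : {linear P 0%N -> M}) : flat_resolution d e ->
  tor_acyclic Y M <-> forall j, exact_at (ltens Y (d j.+1)) (ltens Y (d j)).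
Proof.
move=> Pres; split=> [H|H]; last first.
  by apply: rtens_tor_acyclic => Q q c res; apply/(tor_balance res Pres).
have [Q [q [c res]]] := projective_resolution_exists Y.
exact/(tor_balance res Pres)/(tor_acyclic_rtens res).
Qed.

Lemma Tor_eq0_acyclic : (forall i, (1 <= i)%N -> Tor_eq0 i Y M) <-> tor_acyclic Y M.
Proof.
split=> [H|H [//|j] _ P d e res]; last first.
  exact: (flat_res_tor_acyclic (projective_flat_resolution res)).1.
have [P [d [e res]]] := projective_resolution_exists M.
apply/(flat_res_tor_acyclic (projective_flat_resolution res)) => j.
exact: (H j.+1 isT _ _ _ res).
Qed.

(** Ext^i(M, Y^+) is the character group of Tor_i(Y, M). *)
Lemma Ext_dual_acyclic : tor_acyclic Y M ->
  forall i, (1 <= i)%N -> Ext_eq0 i M (dual Y).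
Proof.
move=> H [//|j] _ P d e res f fd.
exact: ((exact_ltens_dual _ _ _).1 ((Tor_eq0_acyclic.2 H) j.+1 isT P d e res) f).1.
Qed.

End TorAcyclic.

(** * The class F_C *)

Section ProdCharacter.
Variables (R : pzRingType) (C : lmodType R).
Implicit Types (Y Z : lmodType R^c) (M N : lmodType R).

Lemma Prod_chrP Y : Prod_chr C Y <->
  exists (I : Type) (s : {linear Y -> (I -> chr C)}) (r : {linear (I -> chr C) -> Y}),
    forall y, r (s y) = y.
Proof.
split=> [[I [Z [f [g fK gK]]]]|[I [s [r rs]]]].
  have gL : linear g by move=> a x y; apply: (can_inj fK); rewrite gK linearP !gK.
  exists I.
  have [s sE] : exists s : {linear Y -> (I -> chr C)}, forall y, s y = f (y, 0).
    by exists (f \o pair_lin idfun \0).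
  have rL : linear (fun h => (g h).1) by move=> a x y; rewrite gL.
  by exists s, (mk_linear rL) => y; rewrite mk_linearE sE fK.
have fL : linear (fun p : (Y * subm (kernel r))%type => s p.1 + subm_incl _ p.2).
  by move=> a x y; rewrite !linearP scalerDr addrACA.
have kx := @kernel_exact _ _ _ r.
exists I, (subm (kernel r)), (mk_linear fL).
have /choice[t tE] : forall h, exists z, subm_incl (kernel r) z = h - s (r h).
  by move=> h; apply/kx; rewrite linearB rs subrr.
exists (fun h => (r h, t h)) => [[y z]|h]; rewrite mk_linearE /=; last first.
  by rewrite [val _](tE h) addrC subrK.
have rz : r (s y + subm_incl (kernel r) z) = y.
  by rewrite linearD rs (exact_at_comp0 _ kx) addr0.
rewrite [r _]rz; congr (_, _).
by apply: (@subm_incl_inj _ _ (kernel r)); rewrite tE rz addrAC subrr add0r.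
Qed.

Lemma Prod_chr_retract Y Z (s : {linear Y -> Z}) (r : {linear Z -> Y}) :
  (forall y, r (s y) = y) -> Prod_chr C Z -> Prod_chr C Y.
Proof.
move=> rs /Prod_chrP[I [s' [r' rs']]]; apply/Prod_chrP.
by exists I, (s' \o s), (r \o r') => y /=; rewrite rs' rs.
Qed.

Lemma FC_flat_retract M N (s : {linear M -> N}) (r : {linear N -> M}) :
  (forall x, r (s x) = x) -> FC_flat C N -> FC_flat C M.
Proof.
move=> rs; apply: (@Prod_chr_retract _ _ (chr_map r) (chr_map s)) => f.
by apply/chrP => x; rewrite !mk_linearE /= rs.
Qed.

(** The isomorphism of [(C^(J))^+] with [(C^+)^J]: it realizes every product of copies of [C^+] as
    the character module of a module in F_C. *)
Lemma chr_dsum (J : choiceType) :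
  exists (s : {linear chr (dsum J C) -> (J -> chr C)}) (r : {linear (J -> chr C) -> chr (dsum J C)}),
    cancel s r /\ cancel r s.
Proof.
have sL : linear (fun f : chr (dsum J C) => (fun j => f \o dsum_in C j : chr C)).
  move=> a f g; apply/funext => j; apply/chrP => x.
  by rewrite -[LHS]/(f (_ *: dsum_in C j x) + _) -linearZ_LR.
have rL : linear (fun h : J -> chr C =>
    dsum_addlift (fun j => h j : {additive C -> QmodZ}) : chr (dsum J C)).
  move=> a f g; apply/chrP => t.
  set u := dsum_addlift _; set v := (_ *: _ + _ : chr _).
  apply: (@dsum_ext _ _ _ _ u v) => j x; rewrite dsum_addlift_in.
  rewrite -[RHS]/(dsum_addlift _ (_ *: dsum_in C j x) + dsum_addlift _ (dsum_in C j x)).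
  by rewrite -linearZ_LR !dsum_addlift_in.
exists (mk_linear sL), (mk_linear rL); split=> [f|h].
  apply/chrP => t; rewrite !mk_linearE.
  by apply: (@dsum_ext _ _ _ _ (dsum_addlift _) f) => j x; rewrite dsum_addlift_in.
rewrite !mk_linearE; apply/funext => j; apply/chrP => x.
exact: dsum_addlift_in.
Qed.

Lemma FC_flat_dsum (J : choiceType) : FC_flat C (dsum J C).
Proof.
by apply/Prod_chrP; have [s [r [sK _]]] := chr_dsum J; exists J, s, r.
Qed.

Lemma FC_flat_chr_retract M : FC_flat C M ->
  exists (J : choiceType) (s : {linear chr M -> chr (dsum J C)})
    (r : {linear chr (dsum J C) -> chr M}), forall y, r (s y) = y.
Proof.
move=> /Prod_chrP[I [s [r rs]]]; have [s' [r' [_ rK]]] := chr_dsum {classic I}.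
by exists {classic I}, (r' \o s), (r \o s') => y /=; rewrite rK rs.
Qed.

Lemma FC_flat_pow n : FC_flat C ('I_n -> C).
Proof.
have sL : linear (fun f : 'I_n -> C => \sum_i dsum_in C i (f i)).
  move=> a f g; rewrite scaler_sumr -big_split; apply: eq_bigr => i _.
  exact: (linearP (dsum_in C i)).
have rL : linear (fun t : dsum 'I_n C => (fun i => dsum_pr C i t)).
  by move=> a s t; apply/funext => i; rewrite linearP.
apply: (@FC_flat_retract _ (dsum 'I_n C) (mk_linear sL) (mk_linear rL)); last exact: FC_flat_dsum.
move=> f; apply/funext => i; rewrite -[LHS]/(dsum_pr C i (\sum_j dsum_in C j (f j))) linear_sum (bigD1 i) //= big1 ?addr0.
  by rewrite [LHS]dsum_pr_in eqxx.
by move=> j /negPf ji; rewrite [LHS]dsum_pr_in eq_sym ji.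
Qed.

Lemma FC_flat_self : FC_flat C C.
Proof.
have sL : linear (fun x : C => (fun _ => x) : 'I_1 -> C) by move=> a x y; apply/funext.
have rL : linear (fun f : 'I_1 -> C => f ord0) by [].
by apply: (@FC_flat_retract _ _ (mk_linear sL) (mk_linear rL)); last exact: FC_flat_pow.
Qed.

Lemma Tor_eq0_retract i Y Z M (s : {linear Y -> Z}) (r : {linear Z -> Y}) :
  (forall y, r (s y) = y) -> (0 < i)%N -> Tor_eq0 i Z M -> Tor_eq0 i Y M.
Proof.
move=> rs; case: i => // i _ H P d e res.
have rsE N (t : tens Y N) : rtens r N (rtens s N t) = t.
  rewrite (@rtens_comp _ _ _ _ _ _ _ idfun) //.
  by apply: (@tens_ext _ _ _ _ (rtens idfun N) idfun) => y x /=; rewrite rtensE.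
have {}H : exact_at (ltens Z (d i.+1)) (ltens Z (d i)) := H P d e res.
move=> t; split=> [dt|[u <-]].
  have [u uE] : exists u, ltens Z (d i.+1) u = rtens s _ t.
    by apply/H; rewrite -rtens_ltens dt raddf0.
  by exists (rtens r _ u); rewrite -rtens_ltens uE rsE.
rewrite -[LHS]rsE (rtens_ltens s (d i)) (rtens_ltens s (d i.+1)).
by rewrite (exact_at_comp0 _ H) raddf0.
Qed.

(** [M^+] is a summand of a power of [C^+], and vanishing of Ext(Y, -) passes to products and
    summands: cochains are bounded coordinate by coordinate and then retracted. *)
Lemma tor_acyclic_FC Y M : tor_acyclic Y C -> FC_flat C M -> tor_acyclic Y M.
Proof.
move=> YC /Prod_chrP[I [s [r rs]]] [//|k] _ Q q c res f fq.
have /choice[g gE] i : exists g : {linear Q k -> chr C}, forall x, s (f x) i = g (q k x).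
  have prL : linear (fun x => s (f x) i) by move=> a x y; rewrite !linearP.
  apply: (YC k.+1 isT Q q c res (mk_linear prL)) => x.
  by rewrite mk_linearE fq raddf0.
have gL : linear (fun x => (fun i => g i x)) by move=> a x y; apply/funext => i; rewrite linearP.
exists (r \o mk_linear gL) => x; rewrite -[LHS]rs /=; congr (r _).
by apply/funext => i; rewrite gE.
Qed.

Lemma tor_acyclic_Prod Y M : wplus_tilting C -> Prod_chr C Y -> FC_flat C M -> tor_acyclic Y M.
Proof.
move=> [tor _] /Prod_chrP[I [s [r rs]]]; apply: tor_acyclic_FC.
apply/Tor_eq0_acyclic => i i0; apply: (Tor_eq0_retract rs) => //; exact: tor.
Qed.

End ProdCharacter.

(** * Pieces of the long exact sequences of Tor *)

Section TorExactSequences.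
Variable R : pzRingType.
Implicit Types (Y : lmodType R^c) (A B D M P : lmodType R).

Lemma projective_ltens_injective (Q : lmodType R^c) A B (f : {linear A -> B}) :
  projective Q -> injective f -> injective (ltens Q f).
Proof.
move=> Qp fI; apply: raddf_inj => t ft.
have ex : exact_at (\0 : {linear A -> A}) f.
  move=> a; split=> [fa|[x E]]; last by rewrite -E; exact: raddf0.
  by exists 0; apply: fI; rewrite fa raddf0.
have [u <-] := (projective_ltens_exact Qp ex t).1 ft.
by apply: (@tens_ext _ _ _ _ (ltens Q \0) \0) => y x; rewrite [LHS]ltensE tmulr0.
Qed.

Lemma tor_acyclic_cokernel Y A B D (i : {linear A -> B}) (p : {linear B -> D}) :
  short_exact i p -> tor_acyclic Y A -> tor_acyclic Y B -> injective (ltens Y i) ->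
  tor_acyclic Y D.
Proof.
move=> [iI ip pS] YA YB YiI; apply: rtens_tor_acyclic => Q q c res k t.
have tA := tor_acyclic_rtens res YA; have tB := tor_acyclic_rtens res YB.
have [Qp cS qc _] := res.
have pT n : forall t, exists s, ltens (Q n) p s = t by apply: tens_surjective => // z; exists z.
have ipT n := projective_ltens_exact (Qp n) ip.
have iT n := projective_ltens_injective (Qp n) iI.
split=> [qt|[u <-]]; last first.
  have [b <-] := pT _ u; rewrite !rtens_ltens (exact_at_comp0 _ (tB k)); exact: raddf0.
have [b bt] := pT _ t.
have [a ab] : exists a, ltens (Q k) i a = rtens (q k) B b.
  by apply/ipT; rewrite -rtens_ltens bt.
(* In the lowest degree [a] is a boundary because its image in [Y (x) A] dies in [Y (x) B], where
   injectivity of [ltens Y i] applies; in higher degrees acyclicity of [A] suffices. *)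
have [a' a'E] : exists a', rtens (q k) A a' = a.
  case: k t qt b bt a ab => [|k] t qt b bt a ab.
    apply: (@rtens_right_exact _ _ _ _ A _ _ qc cS a).1; apply: YiI; rewrite raddf0 -rtens_ltens ab.
    exact: exact_at_comp0 (@rtens_right_exact _ _ _ _ B _ _ qc cS).
  apply: (tA k a).1; apply: iT; rewrite raddf0 -rtens_ltens ab.
  exact: exact_at_comp0 (tB k).
have [b' b'E] : exists b', rtens (q k.+1) B b' = b - ltens (Q k.+1) i a'.
  by apply/tB; rewrite raddfB /= rtens_ltens a'E ab subrr.
exists (ltens (Q k.+2) p b'); rewrite rtens_ltens b'E raddfB /= bt (exact_at_comp0 _ (ipT _)).
exact: subr0.
Qed.

(** The stretch Tor_1(X, M) -> [Y (x) M] -> [Z (x) M] of the long exact sequence, chased through a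
    projective resolution of [M]. *)
Lemma rtens_injective (Y Z X : lmodType R^c) M (f : {linear Y -> Z}) (g : {linear Z -> X}) :
  short_exact f g -> tor_acyclic X M -> injective (rtens f M).
Proof.
move=> [fI fg gS] XM; apply: raddf_inj => t ft.
have [P [d [e res]]] := projective_resolution_exists M.
have [Pp eS de dd] := res; have Pf n := projective_flat (Pp n).
have /(flat_res_tor_acyclic _ (projective_flat_resolution res)) XP := XM.
have eT W : forall t, exists s, ltens W e s = t by apply: tens_surjective => // z; exists z.
have gT N : forall t, exists s, rtens g N s = t by apply: tens_surjective => // z; exists z.
have [p pt] := eT _ t.
have [z zE] : exists z, ltens Z (d 0%N) z = rtens f _ p.
  by apply/(ltens_right_exact (Y := Z) de eS); rewrite -rtens_ltens pt.
have [w wE] : exists w, ltens X (d 1%N) w = rtens g _ z.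
  apply/XP; rewrite -rtens_ltens zE; exact: exact_at_comp0 (flat_exact (Pf _) fg).
have [w' w'E] := gT _ w.
have [z' z'E] : exists z', rtens f _ z' = z - ltens Z (d 1%N) w'.
  by apply/(flat_exact (Pf _) fg); rewrite raddfB /= rtens_ltens w'E wE subrr.
have -> : t = ltens Y e (ltens Y (d 0%N) z').
  rewrite -pt; congr (ltens Y e _); apply: (Pf 0%N _ _ f fI); rewrite -![tmap _ _ _]/(rtens _ _ _).
  rewrite rtens_ltens z'E raddfB /= zE -[LHS]subr0; congr (_ - _).
  by rewrite ltens_comp0 // => x; apply: exact_at_comp0 (dd 0%N).
exact: exact_at_comp0 (ltens_right_exact (Y := Y) de eS).
Qed.

End TorExactSequences.

(** * G_C-flat modules *)

Section GorensteinFlat.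
Variables (R : pzRingType) (C : lmodType R).
Implicit Types (Y : lmodType R^c) (M N D : lmodType R).

Definition Prod_injective (A B : lmodType R) (f : {linear A -> B}) :=
  forall Y, Prod_chr C Y -> injective (ltens Y f).

(* The same condition as on [R] in [wplus_tilting].                            *)
Definition has_coresolution M :=
  exists (D : nat -> lmodType R) (e : {linear M -> D 0%N})
         (d : forall n, {linear D n -> D n.+1}),
    [/\ forall n, FC_flat C (D n),
        [/\ injective e, exact_at e (d 0%N)
          & forall n, exact_at (d n) (d n.+1)]
      & forall Y, Prod_chr C Y ->
        [/\ injective (ltens Y e), exact_at (ltens Y e) (ltens Y (d 0%N))
          & forall n, exact_at (ltens Y (d n)) (ltens Y (d n.+1))]].

Definition succz (i : int) : int :=
  match i with Posz n => Posz n.+1 | Negz n.+1 => Negz n | Negz 0 => Posz 0 end.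

(* Unlike [fun i => i + 1], [succz] computes, which removes all transports.    *)
Lemma succzE : (fun i : int => i + 1) = succz.
Proof.
apply/funext => -[n|[|n]] //=; first by rewrite -PoszD addn1.
by rewrite !NegzE -[n.+2%:Z]/(Posz n.+2) -[n.+2]addn1 PoszD opprD subrK.
Qed.

Lemma GC_flat_succz M : GC_flat C M <->
  exists (X : int -> lmodType R) (d : forall i, {linear X (succz i) -> X i}),
    [/\ forall i, 0 <= i -> flat (X i),
        forall i, i < 0 -> FC_flat C (X i),
        forall i, exact_at (d (succz i)) (d i),
        forall Y, Prod_chr C Y ->
          forall i, exact_at (ltens Y (d (succz i))) (ltens Y (d i))
      & exists f : {linear M -> X (-1)}, injective f /\
          forall x, (exists m, f m = x) <-> (exists y, d (-1) y = x)].
Proof.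
pose P (s : int -> int) :=
  exists (X : int -> lmodType R) (d : forall i, {linear X (s i) -> X i}),
    [/\ forall i, 0 <= i -> flat (X i),
        forall i, i < 0 -> FC_flat C (X i),
        forall i, exact_at (d (s i)) (d i),
        forall Y, Prod_chr C Y ->
          forall i, exact_at (ltens Y (d (s i))) (ltens Y (d i))
      & exists f : {linear M -> X (-1)}, injective f /\
          forall x, (exists m, f m = x) <-> (exists y, d (-1) y = x)].
by rewrite -[GC_flat C M]/(P (fun i => i + 1)) succzE.
Qed.

(** The complex is cut at [M]. Its flat half is a resolution computing Tor(Y, M), so exactness after
    tensoring says that [M] is acyclic; the other half is the coresolution. *)
Lemma GC_flat_data M : GC_flat C M ->
  (forall Y, Prod_chr C Y -> tor_acyclic Y M) /\ has_coresolution M.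
Proof.
move=> /GC_flat_succz[X [d [Xf Xc ex exY [f [fI fim]]]]].
have [x|q qE] := @linear_cofactor _ _ _ _ f (d (-1)) fI.
  by apply/fim; exists x.
have qS m : exists x, q x = m.
  have [|x xm] := (fim (f m)).1; first by exists m.
  by exists x; apply: fI; rewrite qE.
have ex0 : exact_at (d 0) q.
  move=> b; apply: iff_trans (ex (-1) b); rewrite -qE; split=> [->|]; first exact: raddf0.
  by move=> H; apply: fI; rewrite H raddf0.
have res : @flat_resolution R M (fun n => X (Posz n)) (fun n => d (Posz n)) q.
  by split=> // n; [apply: Xf|exact: (ex (Posz n))].
have qT Y : forall t, exists s, ltens Y q s = t.
  by apply: tens_surjective => // z; exists z.
have qfE Y := ltens_comp (Y := Y) qE.
split=> [Y YP|].
  by apply/(flat_res_tor_acyclic _ res) => j; exact: (exY Y YP (Posz j)).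
exists (fun n => X (Negz n)), f, (fun n => d (Negz n.+1)); split=> [n||Y YP].
- exact: Xc.
- split=> // [x|n]; last exact: (ex (Negz n.+2)).
  exact: iff_trans (ex (Negz 1) x) (iff_sym (fim x)).
split=> [|t|n]; last exact: (exY Y YP (Negz n.+2)).
  apply: raddf_inj => t; have [s <-] := qT _ t.
  rewrite [X in X = 0 -> _]qfE => /(exY Y YP (Negz 0))[u <-].
  exact: exact_at_comp0 (ltens_right_exact (Y := Y) ex0 qS).
apply: iff_trans (exY Y YP (Negz 1) t) _; split=> [[s <-]|[s <-]].
  by exists (ltens Y q s); rewrite qfE.
by have [u <-] := qT _ s; exists u; rewrite qfE.
Qed.

(** Acyclicity does not depend on the resolution, so any projective resolution can serve as the flat
    half. *)
Lemma GC_flat_of_data M : (forall Y, Prod_chr C Y -> tor_acyclic Y M) ->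
  has_coresolution M -> GC_flat C M.
Proof.
move=> MY [D [f [d [Dc [fI fd dd] dY]]]]; apply/GC_flat_succz.
have [P [p [q res]]] := projective_resolution_exists M.
have [Pp qS pq pp] := res.
pose X (i : int) : lmodType R := match i with Posz n => P n | Negz n => D n end.
have [g gE] : exists g : {linear P 0%N -> D 0%N}, forall x, g x = f (q x) by exists (f \o q).
pose del (i : int) : {linear X (succz i) -> X i} :=
  match i return {linear X (succz i) -> X i} with
  | Posz n => p n
  | Negz n => match n return {linear X (succz (Negz n)) -> X (Negz n)} with
              | 0%N => g | k.+1 => d k end
  end.
have qT Y : forall t, exists s, ltens Y q s = t.
  by apply: tens_surjective => // z; exists z.
have gT Y t : ltens Y g t = ltens Y f (ltens Y q t).
  by rewrite (@ltens_comp _ _ _ _ _ q f g).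
exists X, del; split.
- by case=> // n _; apply: projective_flat; apply: Pp.
- by case=> // n _; exact: Dc.
- case=> [n|[|[|n]]] b; first exact: pp.
  + apply: iff_trans (pq b); rewrite -[del _ b]/(g b) gE; split=> [|->]; last exact: raddf0.
    by move=> H; apply: fI; rewrite H raddf0.
  + apply: iff_trans (fd b) _; split=> [[m <-]|[x <-]]; last by exists (q x); exact/esym/gE.
    by have [x <-] := qS m; exists x; exact: gE.
  + exact: dd.
- move=> Y YP; have [fY fdY ddY] := dY Y YP.
  have exYP := (flat_res_tor_acyclic _ (projective_flat_resolution res)).1 (MY Y YP).
  case=> [n|[|[|n]]] b; first exact: exYP.
  + apply: iff_trans (ltens_right_exact (Y := Y) pq qS b).
    rewrite -[ltens Y (del _) b]/(ltens Y g b) gT; split=> [|->]; last exact: raddf0.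
    by move=> H; apply: fY; rewrite H raddf0.
  + apply: iff_trans (fdY b) _; split=> [[m <-]|[x <-]]; last by exists (ltens Y q x); exact/esym/gT.
    by have [x <-] := qT _ m; exists x; exact: gT.
  + exact: ddY.
exists f; split=> // x; split=> [[m <-]|[y <-]]; last by exists (q y); exact/esym/gE.
by have [y <-] := qS m; exists y; exact: gE.
Qed.

Lemma GC_flat_coresolution_step M : GC_flat C M ->
  exists D N (i : {linear M -> D}) (p : {linear D -> N}),
    [/\ FC_flat C D, short_exact i p, Prod_injective i & has_coresolution N].
Proof.
move=> /GC_flat_data[_ [D [i [d [Dc [iI id dd] dY]]]]].
have [N [p [ip pS]]] := cokernel_exists i.
have idx x : d 0%N x = 0 <-> p x = 0 by rewrite id ip.
exists (D 0%N), N, i, p; split=> // [Y YP|]; first by have [] := dY Y YP.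
have [|x /idx|j jE] := @linear_factor _ _ _ _ p (d 0%N); [exact: pS|by []|].
exists (fun n => D n.+1), j, (fun n => d n.+1); split=> // [|Y YP].
  split=> // [|x].
    by apply: linear_eq0 => y; have [x <-] := pS y; rewrite jE => /idx.
  apply: iff_trans (dd 0%N x) _; split=> [[y <-]|[y <-]]; first by exists (p y); rewrite jE.
  by have [z <-] := pS y; exists z; rewrite jE.
have [iY idY ddY] := dY Y YP.
have pT : forall t, exists s, ltens Y p s = t by apply: tens_surjective => // z; exists z.
have jT := ltens_comp (Y := Y) jE.
split=> // [|x].
  apply: raddf_inj => t; have [s <-] := pT t; rewrite [X in X = 0 -> _]jT => /idY[u <-].
  exact: exact_at_comp0 (ltens_right_exact (Y := Y) ip pS).
apply: iff_trans (ddY 0%N x) _; split=> [[y <-]|[y <-]]; first by exists (ltens Y p y); rewrite jT.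
by have [z <-] := pT y; exists z; rewrite jT.
Qed.

Hypothesis tilting : wplus_tilting C.

Lemma FC_GC_flat M : FC_flat C M -> GC_flat C M.
Proof.
move=> Mc; apply: GC_flat_of_data => [Y YP|]; first exact: (tor_acyclic_Prod tilting YP Mc).
(* The zero module is written as the empty power of [C], so that [FC_flat_pow] places it in F_C. *)
pose Z : lmodType R := 'I_0 -> C.
have Z0 (z : Z) : z = 0 by apply/funext => -[].
have ZT Y (t : tens Y Z) : t = 0.
  by elim/tens_ind: t => // [t u -> ->|t ->|y x]; rewrite ?addr0 ?oppr0 // (Z0 x) tmulr0.
exists (fun n => if n is 0%N then M else Z), idfun, (fun n => \0); split.
- by case=> // n; exact: FC_flat_pow.
- split=> // [x|[|n] x]; split=> // _; first by exists x.
    by exists 0; apply/esym/Z0.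
  by exists 0; apply/esym/Z0.
move=> Y YP; have idT (t : tens Y M) : ltens Y idfun t = t.
  by apply: (@tens_ext _ _ _ _ (ltens Y idfun) idfun) => y x; rewrite [LHS]ltensE.
split=> [t u|t|[|n] t]; first by rewrite !idT.
- by split=> [_|_]; [exists t; rewrite idT|rewrite [LHS]ZT].
- by split=> [_|_]; [exists 0; rewrite [RHS]ZT [LHS]ZT|rewrite [LHS]ZT].
- by split=> [_|_]; [exists 0; rewrite [RHS]ZT [LHS]ZT|rewrite [LHS]ZT].
Qed.

(** The cokernel is again G_C-flat: it inherits the shifted coresolution, and its Tor_1 vanishes
    because [i] stays injective after tensoring. *)
Lemma GC_flat_embedding M : GC_flat C M ->
  exists D N (i : {linear M -> D}) (p : {linear D -> N}),
    [/\ FC_flat C D, GC_flat C N, short_exact i p & Prod_injective i].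
Proof.
move=> Mg; have [D [N [i [p [Dc ip iY Nc]]]]] := GC_flat_coresolution_step Mg.
exists D, N, i, p; split=> //; apply: GC_flat_of_data => // Y YP.
have [MY _] := GC_flat_data Mg.
apply: (tor_acyclic_cokernel ip); [exact: MY|exact: (tor_acyclic_Prod tilting YP Dc)|exact: iY].
Qed.

Lemma flat_tor_acyclic Y M : flat M -> tor_acyclic Y M.
Proof.
move=> Mf; apply: rtens_tor_acyclic => Q q c [_ _ _ qq] k; exact: flat_exact.
Qed.

Lemma projective_regular : projective (R^o : lmodType R).
Proof.
move=> A B p f pS; have [a ap] := pS (f 1); exists (scale_lin a) => r.
rewrite mk_linearE linearZ_LR ap -linearZ_LR; congr (f _); exact: mulr1.
Qed.

Lemma GC_flat_regular : GC_flat C R^o.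
Proof.
apply: GC_flat_of_data; last exact: tilting.2.
by move=> Y _; apply/flat_tor_acyclic/projective_flat/projective_regular.
Qed.

End GorensteinFlat.

(** * Duality for finitely presented modules *)

Section CharacterPairing.
Variable R : pzRingType.
Implicit Types (A B E M N D U V : lmodType R).

Lemma tens_trace_exists M :
  exists f : {additive tens (chr M) M -> QmodZ}, forall l x, f (tmul l x) = l x.
Proof. by apply: tlift_exists; split=> // y x x'; exact: raddfD. Qed.

Definition tens_trace M : {additive tens (chr M) M -> QmodZ} := sval (cid (tens_trace_exists M)).

Lemma tens_traceE M (l : chr M) x : tens_trace M (tmul l x) = l x.
Proof. by rewrite /tens_trace; case: cid. Qed.

Lemma tens_trace_chr_map M N (f : {linear M -> N}) t :
  tens_trace N (ltens (chr N) f t) = tens_trace M (rtens (chr_map f) M t).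
Proof.
apply: (@tens_ext _ _ _ _ (tens_trace N \o ltens (chr N) f)
  (tens_trace M \o rtens (chr_map f) M)) => y x /=.
by rewrite ltensE rtensE !tens_traceE.
Qed.

(** On [tmul l x] and [h] the value is [l (h x)]: this is the tensor evaluation from [D^+ (x) U] to
    the character group of Hom(U, D). *)
Definition hom_pairing U D (t : tens (chr D) U) (h : lhom U D) : QmodZ :=
  tens_trace D (ltens (chr D) h t).

Lemma ltens_lhomB U Y D (h k : lhom U D) (t : tens Y U) :
  ltens Y (h - k : lhom U D) t = ltens Y h t - ltens Y k t.
Proof.
have [_ mDr _] := tmul_balanced Y D.
apply: (@tens_ext _ _ _ _ (ltens Y (h - k : lhom U D)) (ltens Y h \- ltens Y k)) => y x /=.
rewrite !ltensE -[(h - k : lhom U D) x]/(h x - k x).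
by apply: (addIr (tmul y (k x))); rewrite -mDr !subrK.
Qed.

Fact hom_pairing_additive U D t : zmod_morphism (@hom_pairing U D t).
Proof. by move=> h k; rewrite /hom_pairing ltens_lhomB raddfB. Qed.

Fact hom_pairing_additive_tens U D t s (h : lhom U D) :
  hom_pairing (t - s) h = hom_pairing t h - hom_pairing s h.
Proof. by rewrite /hom_pairing !raddfB. Qed.

(* For finitely presented [U] the pairing identifies [D^+ (x)_R U] with         *)
(* [Hom_R(U, D)^+]; this is the only form of finite presentation needed.       *)
Definition char_dualizable U := forall D,
  (forall t : tens (chr D) U, (forall h, hom_pairing t h = 0) -> t = 0) /\
  (forall chi : {additive lhom U D -> QmodZ}, exists t, forall h, chi h = hom_pairing t h).

Lemma hom_pairing_eq U D (s t : tens (chr D) U) : char_dualizable U ->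
  (forall h, hom_pairing s h = hom_pairing t h) -> s = t.
Proof.
move=> Ud st; apply/eqP; rewrite -subr_eq0; apply/eqP; apply: (Ud D).1 => h.
by rewrite hom_pairing_additive_tens st subrr.
Qed.

Lemma hom_pairing_ltens U V D (f : {linear U -> V}) t (h : lhom V D) (k : lhom U D) :
  (forall x, h (f x) = k x) -> hom_pairing (ltens (chr D) f t) h = hom_pairing t k.
Proof. by move=> hk; rewrite /hom_pairing (ltens_comp (h := k)). Qed.

Fact precomp_additive U V D (f : {linear U -> V}) :
  zmod_morphism (fun h : lhom V D => h \o f : lhom U D).
Proof. by move=> h k; apply/lhomP. Qed.
Definition precomp U V D (f : {linear U -> V}) : {additive lhom V D -> lhom U D} :=
  mk_additive (@precomp_additive U V D f).

Lemma hom_pairing_precomp U V D (f : {linear U -> V}) t (h : lhom V D) :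
  hom_pairing (ltens (chr D) f t) h = hom_pairing t (precomp D f h).
Proof. exact: hom_pairing_ltens. Qed.

Lemma char_dualizable_retract U V (s : {linear V -> U}) (r : {linear U -> V}) :
  (forall x, r (s x) = x) -> char_dualizable U -> char_dualizable V.
Proof.
move=> rs Ud D; have [Ui Us] := Ud D.
have rsE (t : tens (chr D) V) : ltens _ r (ltens _ s t) = t.
  rewrite (ltens_comp (h := idfun)) //.
  by apply: (@tens_ext _ _ _ _ (ltens _ idfun) idfun) => y x; rewrite [LHS]ltensE.
split=> [t tP|chi].
  by rewrite -[t]rsE (Ui (ltens _ s t)) ?raddf0 // => h; rewrite hom_pairing_precomp.
have [t tE] := Us (chi \o precomp D s : {additive _ -> _}).
exists (ltens _ r t) => h; rewrite hom_pairing_precomp -tE /=; congr (chi _).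
by apply/lhomP => x; rewrite /= rs.
Qed.

Lemma char_dualizable_regular : char_dualizable R^o.
Proof.
move=> D; have [mDl mDr mZ] := tmul_balanced (chr D) R^o.
have gen (t : tens (chr D) R^o) : exists l, t = tmul l (1 : R^o).
  elim/tens_ind: t => [|_ _ [l ->] [k ->]|_ [l ->]|y x].
  - by exists 0; rewrite tmul0r.
  - by exists (l + k); rewrite mDl.
  - by exists (- l); apply: (addIr (tmul l (1 : R^o))); rewrite -mDl !addNr tmul0r.
  - by exists ((x : R^c) *: y); rewrite mZ; congr tmul; apply/esym/mulr1.
split=> [t|chi].
  have [l ->] := gen t => lP; suff -> : l = 0 by rewrite tmul0r.
  apply/chrP => x; have := lP (scale_lin x).
  by rewrite /hom_pairing ltensE tens_traceE mk_linearE scale1r.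
have ad : zmod_morphism (fun x : D => chi (scale_lin x)).
  move=> x y; rewrite -raddfB; congr (chi _); apply/lhomP => r.
  exact: scalerBr.
exists (tmul (mk_additive ad : chr D) (1 : R^o)) => h.
rewrite /hom_pairing ltensE tens_traceE; congr (chi _); apply/lhomP => r.
by rewrite mk_linearE -linearZ_LR; congr (h _); apply/esym/mulr1.
Qed.

Fact pow_in_linear n U (i : 'I_n) : linear (fun (x : U) (j : 'I_n) => if j == i then x else 0).
Proof.
move=> a x y; apply/funext => j.
rewrite -[RHS]/(a *: (if j == i then x else 0) + (if j == i then y else 0)).
by case: eqP => _ //; rewrite scaler0 addr0.
Qed.
Definition pow_in n U (i : 'I_n) : {linear U -> ('I_n -> U)} := mk_linear (pow_in_linear i).

Fact pow_pr_linear n U (i : 'I_n) : linear (fun f : 'I_n -> U => f i).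
Proof. by []. Qed.
Definition pow_pr n U (i : 'I_n) : {linear ('I_n -> U) -> U} := mk_linear (pow_pr_linear i).

Lemma pow_decomp n U (f : 'I_n -> U) : f = \sum_i pow_in U i (pow_pr U i f).
Proof.
apply/funext => j; rewrite fct_sumE (bigD1 j) //= big1 ?addr0 ?eqxx // => i ij.
by rewrite eq_sym (negPf ij).
Qed.

Lemma char_dualizable_pow n U : char_dualizable U -> char_dualizable ('I_n -> U).
Proof.
move=> Ud D; have [Ui Us] := Ud D.
have decT (t : tens (chr D) ('I_n -> U)) :
    t = \sum_i ltens _ (pow_in U i) (ltens _ (pow_pr U i) t).
  have ad : zmod_morphism (fun t : tens (chr D) ('I_n -> U) =>
      \sum_i ltens _ (pow_in U i) (ltens _ (pow_pr U i) t)).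
    by move=> u v; rewrite -sumrB; apply: eq_bigr => i _; rewrite !raddfB.
  apply: (@tens_ext _ _ _ _ idfun (mk_additive ad)) => y x; rewrite [RHS]mk_additiveE.
  have yad : zmod_morphism (fun x : 'I_n -> U => tmul y x).
    have [_ mDr _] := tmul_balanced (chr D) ('I_n -> U).
    by move=> u v; apply: (addIr (tmul y v)); rewrite -mDr !subrK.
  rewrite -[LHS]/(tmul y x) {1}(pow_decomp x) -[LHS]/(mk_additive yad _) raddf_sum.
  by apply: eq_bigr => i _; rewrite !ltensE.
split=> [t tP|chi].
  rewrite (decT t) big1 // => i _; rewrite (Ui (ltens _ _ t)) ?raddf0 // => h.
  by rewrite hom_pairing_precomp.
have /choice[t tE] (i : 'I_n) : exists t, forall h : lhom U D,
    chi (precomp D (pow_pr U i) h) = hom_pairing t h.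
  by have [t tE] := Us (chi \o precomp D (pow_pr U i) : {additive _ -> _}); exists t => h; rewrite -tE.
exists (\sum_i ltens _ (pow_in U i) (t i)) => h.
rewrite /hom_pairing !raddf_sum /=.
rewrite (eq_bigr (fun i => chi (precomp D (pow_pr U i) (precomp D (pow_in U i) h)))) => [|i _].
  rewrite -raddf_sum; congr (chi _); apply/lhomP => x.
  rewrite {1}(pow_decomp x) raddf_sum.
  by elim/big_rec2: _ => // i u v _ ->.
by rewrite -[LHS]/(hom_pairing (ltens _ (pow_in U i) (t i)) h) tE hom_pairing_precomp.
Qed.

(** A five lemma argument. If [ltens _ p t0] pairs to zero with all of Hom(U, D), the pairing with
    [t0] kills the maps vanishing on the image of [f], hence extends along [precomp D f]; the
    element representing the extension shows that [t0] comes from [U1]. Surjectivity follows by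
    extending a character along [precomp D p]. *)
Lemma char_dualizable_cokernel U1 U0 U (f : {linear U1 -> U0}) (p : {linear U0 -> U}) :
  exact_at f p -> (forall x, exists y, p y = x) ->
  char_dualizable U1 -> char_dualizable U0 -> char_dualizable U.
Proof.
move=> fp pS Ud1 Ud0 D; have [U1i U1s] := Ud1 D; have [U0i U0s] := Ud0 D.
have pT : forall t, exists s, ltens (chr D) p s = t.
  by apply: tens_surjective => // z; exists z.
split=> [t|chi].
  have [t0 <-] := pT t => tP.
  have [|psi psiE] := @character_extension _ _ (precomp D f) (mk_additive (hom_pairing_additive t0)).
    move=> h hf; rewrite mk_additiveE.
    have [//|x /fp[y <-]|k kE] := @linear_factor _ _ _ _ p h.
      by have /lhomP/(_ y) := hf.
    rewrite -(tP k) hom_pairing_precomp; congr (hom_pairing _ _).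
    by apply/lhomP => x; rewrite -kE.
  have [t1 t1E] := U1s psi.
  suff -> : t0 = ltens _ f t1 by apply: exact_at_comp0 (ltens_right_exact (Y := chr D) fp pS).
  apply: hom_pairing_eq => // h.
  by rewrite hom_pairing_precomp -t1E psiE.
have [|chi0 chi0E] := @character_extension _ _ (precomp D p) chi.
  move=> h hp; suff -> : h = 0 by rewrite raddf0.
  apply/lhomP => x; have [y <-] := pS x; by have /lhomP/(_ y) := hp.
have [t0 t0E] := U0s chi0.
by exists (ltens _ p t0) => h; rewrite hom_pairing_precomp -t0E chi0E.
Qed.

Lemma finitely_generated_cover U : finitely_generated U ->
  exists n (f : {linear ('I_n -> R^o) -> U}), forall x, exists y, f y = x.
Proof.
move=> [n [v vP]]; have L : linear (fun r : 'I_n -> R^o => \sum_i (r i : R) *: v i).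
  move=> a r s; rewrite scaler_sumr -big_split; apply: eq_bigr => i _.
  by rewrite scalerA; exact: scalerDl.
by exists n, (mk_linear L) => x; have [r ->] := vP x; exists r.
Qed.

Lemma char_dualizable_projective U : projective U -> finitely_generated U -> char_dualizable U.
Proof.
move=> Up /finitely_generated_cover[n [f fS]].
have [s sE] := Up _ _ f idfun fS.
exact/(char_dualizable_retract sE)/char_dualizable_pow/char_dualizable_regular.
Qed.

(** On dualizable modules the complex [N^+ (x) -] is the character dual of the complex Hom(-, N),
    and Q/Z detects exactness. *)
Lemma char_dualizable_exact A B E N (f : {linear A -> B}) (g : {linear B -> E}) :
  char_dualizable A -> char_dualizable B -> char_dualizable E ->
  exact_at (ltens (chr N) f) (ltens (chr N) g) <->
  forall h : {linear B -> N}, (forall x, h (f x) = 0) <->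
    exists k : {linear E -> N}, forall x, h x = k (g x).
Proof.
move=> Ad Bd Ed; pose hom_ex := exact_at (precomp N g) (precomp N f).
suff -> : exact_at (ltens (chr N) f) (ltens (chr N) g) <-> hom_ex.
  split=> H h; split.
  - move=> hf; have [|k kE] := (H h).1; first by apply/lhomP => x; exact: hf.
    by exists k => x; rewrite -kE.
  - move=> [k kE] x; have /lhomP/(_ x) : precomp N f h = 0; last by [].
    by apply/H; exists k; apply/lhomP => y; rewrite kE.
  - move=> /lhomP hf; have [|k kE] := (H h).1; first by [].
    by exists k; apply/lhomP => x; rewrite kE.
  - by move=> [k <-]; apply/lhomP; apply: (H _).2; exists k.
rewrite /hom_ex; split=> [H|/exact_coexact H t]; first (apply/exact_coexact => chi).
  have [t tE] := (Bd N).2 chi; have Ht := H t; split=> [chig|[psi psiE] k].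
    have [|s sE] := Ht.1.
      by apply: (Ed N).1 => h; rewrite hom_pairing_precomp -tE chig.
    exists (mk_additive (hom_pairing_additive s)) => h.
    by rewrite tE -sE hom_pairing_precomp.
  have [s sE] := (Ad N).2 psi.
  have ts : t = ltens _ f s.
    by apply: hom_pairing_eq => // h; rewrite -tE psiE sE hom_pairing_precomp.
  rewrite tE -hom_pairing_precomp ts (exact_at_comp0 _ H).
  by rewrite /hom_pairing !raddf0.
have Ht := H (mk_additive (hom_pairing_additive t)); split=> [gt|[s <-]].
  have [k|psi psiE] := Ht.1.
    by rewrite mk_additiveE -hom_pairing_precomp gt /hom_pairing !raddf0.
  have [s sE] := (Ad N).2 psi; exists s.
  by apply: hom_pairing_eq => // h; rewrite hom_pairing_precomp -sE -psiE.
apply: (Ed N).1 => k; rewrite hom_pairing_precomp.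
have Hs := H (mk_additive (hom_pairing_additive (ltens _ f s))).
apply: Hs.2; exists (mk_additive (hom_pairing_additive s)) => h.
by rewrite !mk_additiveE hom_pairing_precomp.
Qed.

End CharacterPairing.

(** * A coresolution of R by finite powers of C *)

Section Factorization.
Variables (R : pzRingType) (C : lmodType R).
Implicit Types (D U : lmodType R).

Lemma finitely_generated_supp (J : choiceType) U (h : {linear U -> dsum J C}) :
  finitely_generated U -> exists l : seq J, uniq l /\
    forall x j, j \notin l -> dsum_pr C j (h x) = 0.
Proof.
move=> [n [v vP]]; have /choice[l lP] i := dsum_supp (h (v i)).
exists (undup (flatten [seq l i | i <- enum 'I_n])); split; first exact: undup_uniq.
move=> x j; rewrite mem_undup => jl; have [r ->] := vP x.
rewrite !linear_sum big1 // => i _; rewrite !linearZ_LR (lP i).2 ?scaler0 //.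
by apply: contraNN jl => jl; apply/flatten_mapP; exists i => //; rewrite mem_enum.
Qed.

Section Factor.
Variables (D U : lmodType R) (phi : lhom U D).
Hypotheses (Cd : char_dualizable C) (Ud : char_dualizable U) (Ug : finitely_generated U).
Hypothesis (Df : FC_flat C D).

(** [dsum] takes modules, so the group Hom(C, D) is regarded as a module over [int]. *)
Let V : lmodType int := ssrint.zmodule (lhom C D).
Let comp_sum : {additive dsum (lhom U C) V -> lhom U D} :=
  dsum_addlift (fun g : lhom U C => precomp D g : {additive V -> lhom U D}).

(** If [t] pairs to zero with all composites U -> C -> D, dualizability of [C] and then of [U] shows
    that every [pi : D^+ -> C^+] kills [t]. These maps are enough: [D^+] is a summand of some
    [(C^(J))^+], and a map from the finitely generated [U] to [C^(J)] meets only finitely many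
    coordinates. *)
Let comp_sum_separates (t : tens (chr D) U) :
  (forall s, hom_pairing t (comp_sum s) = 0) -> t = 0.
Proof.
move=> tP; have tc (g : lhom U C) (f : lhom C D) : hom_pairing t (precomp D g f) = 0.
  by rewrite -(tP (dsum_in V g f)) /comp_sum dsum_addlift_in.
have piT (pi : {linear chr D -> chr C}) : rtens pi U t = 0.
  apply: (Ud C).1 => g; rewrite /hom_pairing -rtens_ltens.
  suff -> : ltens (chr D) g t = 0 by rewrite !raddf0.
  by apply: (Cd D).1 => f; rewrite hom_pairing_precomp tc.
have [J [s [r rs]]] := FC_flat_chr_retract Df.
have -> : t = rtens r U (rtens s U t).
  rewrite (rtens_comp (h := idfun)) //.
  by apply: (@tens_ext _ _ _ _ idfun (rtens idfun U)) => y x; rewrite [RHS]rtensE.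
suff -> : rtens s U t = 0 by rewrite raddf0.
apply: (Ud (dsum J C)).1 => h; have [l [lU lP]] := finitely_generated_supp h Ug.
have -> : h = \sum_(j <- l) (dsum_in C j \o (dsum_pr C j \o h) : lhom _ _).
  apply/lhomP => x; rewrite {1}(dsum_decomp lU (lP x)).
  by elim/big_rec2: _ => // j u v _ ->.
rewrite -[hom_pairing _]/(mk_additive (hom_pairing_additive _) : _ -> _).
rewrite raddf_sum big1_seq // => j _.
rewrite mk_additiveE /hom_pairing -(ltens_comp (f := dsum_pr C j \o h) (g := dsum_in C j)) //.
rewrite tens_trace_chr_map -rtens_ltens.
rewrite (rtens_comp (h := chr_map (dsum_in C j) \o s)) //.
by rewrite rtens_ltens piT !raddf0.
Qed.

(** If [phi] were not a finite sum of composites U -> C -> D, a character would separate it from all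
    such sums. That character is the pairing with some [t] in [D^+ (x) U], which must be zero. *)
Lemma factor_through_pow : exists n (a : {linear U -> ('I_n -> C)}) (b : {linear ('I_n -> C) -> D}),
  forall x, b (a x) = phi x.
Proof.
have [s sE] : exists s, comp_sum s = phi.
  apply: contrapT => nphi; have [|chi chiE chiphi] := @character_separation _ _ comp_sum phi.
    by move=> s sE; apply: nphi; exists s.
  have [t tE] := (Ud D).2 chi; apply: chiphi.
  have t0 : t = 0 by apply: comp_sum_separates => s; rewrite -tE chiE.
  by rewrite tE t0 /hom_pairing !raddf0.
have [l [lU lP]] := dsum_supp s.
pose g (i : 'I_(size l)) : lhom U C := tnth (in_tuple l) i.
pose k (i : 'I_(size l)) : lhom C D := dsum_pr V (g i) s.
have aL : linear (fun x i => g i x) by move=> a x y; apply/funext => i; rewrite linearP.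
have bL : linear (fun f : 'I_(size l) -> C => \sum_i k i (f i)).
  by move=> a x y; rewrite scaler_sumr -big_split; apply: eq_bigr => i _; exact: (linearP (k i)).
exists (size l), (mk_linear aL), (mk_linear bL) => x.
rewrite -sE /comp_sum mk_additiveE (dsum_lift_funE _ lU lP) !mk_linearE.
rewrite (big_tnth _ _ l).
by elim/big_rec2: _ => // j u v _ ->.
Qed.

End Factor.
End Factorization.

Section CoresolutionStep.
Variables (R : pzRingType) (C : lmodType R).
Hypotheses (closed : GCF_closed C) (tilting : wplus_tilting C).
Hypotheses (Cd : char_dualizable C) (Cg : finitely_generated C).
Implicit Types (U V D : lmodType R).

(* Being G_C-flat up to a summand in F_C is what survives the step below.      *)
Definition coresolvable U := [/\ char_dualizable U, finitely_generated U &
  exists D, FC_flat C D /\ GC_flat C (U * D)%type].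

Lemma finitely_generated_onto U V (p : {linear U -> V}) :
  (forall x, exists y, p y = x) -> finitely_generated U -> finitely_generated V.
Proof.
move=> pS [n [v vP]]; exists n, (fun i => p (v i)) => x.
have [y <-] := pS x; have [r ->] := vP y; exists r.
by rewrite linear_sum; apply: eq_bigr => i _; rewrite linearZ_LR.
Qed.

Lemma finitely_generated_pow n U : finitely_generated U -> finitely_generated ('I_n -> U).
Proof.
move=> /finitely_generated_cover[m [f fS]].
have vP (x : 'I_n -> U) : exists r : 'I_n -> 'I_m -> R^o, forall i, f (r i) = x i.
  by have /choice[r rE] i := fS (x i); exists r.
pose e (j : 'I_m) : 'I_m -> R^o := pow_in R^o j 1.
pose w (ij : 'I_n * 'I_m) : 'I_n -> U := pow_in U ij.1 (f (e ij.2)).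
exists #|{: 'I_n * 'I_m}|, (fun k => w (enum_val k)) => x.
have [r rE] := vP x; exists (fun k => r (enum_val k).1 (enum_val k).2).
rewrite -(reindex (fun k => enum_val k) (P := xpredT)
  (F := fun ij : 'I_n * 'I_m => (r ij.1 ij.2 : R) *: w ij)); last first.
  by apply: onW_bij; apply: enum_val_bij.
rewrite -(pair_big xpredT xpredT (fun i j => (r i j : R) *: w (i, j))) /=.
rewrite {1}(pow_decomp x); apply: eq_bigr => i _.
rewrite -[pow_pr _ _ _]/(x i) -rE {1}(pow_decomp (r i)) !linear_sum.
apply: eq_bigr => j _; rewrite -!linearZ_LR; congr (pow_in U i (f (pow_in R^o j _))).
exact/esym/mulr1.
Qed.

(* With [U * D] embedded in [E] and [U -> E] factored through [C^n], the exact   *)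
(* sequences 0 -> D -> E/U -> E/(U * D) -> 0 and 0 -> C^n -> U' * E -> E/U -> 0   *)
(* show that [U' * E] is G_C-flat.                                              *)
Lemma coresolvable_step U : coresolvable U ->
  exists n (U' : lmodType R) (a : {linear U -> ('I_n -> C)}) (p : {linear ('I_n -> C) -> U'}),
    [/\ short_exact a p, Prod_injective C a & coresolvable U'].
Proof.
move=> [Ud Ug [D [Dc UDg]]].
have [E [N [i [q [Ec Ng [iI iq qS] iY]]]]] := GC_flat_embedding tilting UDg.
have [phi phiE] : exists phi : {linear U -> E}, forall x, phi x = i (x, 0).
  by exists (i \o pair_lin idfun \0).
have [n [a [b abE]]] := factor_through_pow phi Cd Ud Ug Ec.
have aI : injective a.
  apply: linear_eq0 => x ax; have : i (x, 0) = i (0, 0) by rewrite -phiE -abE ax !raddf0.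
  by move=> /iI [].
have aY : Prod_injective C a.
  move=> Y YP; apply: raddf_inj => t at0.
  have : ltens Y i (ltens Y (pair_lin idfun \0 : {linear U -> (U * D)%type}) t) = 0.
    rewrite (ltens_comp (h := phi)) // -(ltens_comp (f := a) (g := b)) //.
    by rewrite [X in ltens Y b X]at0 raddf0.
  rewrite -(raddf0 (ltens Y i)) => /(iY Y YP) t0.
  have fL : linear (fun x : (U * D)%type => x.1) by [].
  have : ltens Y (mk_linear fL) (ltens Y (pair_lin idfun \0 : {linear U -> (U * D)%type}) t) = t.
    rewrite (ltens_comp (h := idfun)) //.
    by apply: (@tens_ext _ _ _ _ (ltens Y idfun) idfun) => y x; rewrite [LHS]ltensE.
  by rewrite t0 raddf0.
have [U' [p [ap pS]]] := cokernel_exists a.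
exists n, U', a, p; split=> //.
have Pd := char_dualizable_pow n Cd; have Pg := finitely_generated_pow n Cg.
split; [exact: char_dualizable_cokernel ap pS Ud Pd|exact: finitely_generated_onto pS Pg|].
exists E; split=> //.
have [W [f [fx fS]]] := cokernel_exists (phi : {linear U -> E}).
have Wg : GC_flat C W.
  have [j jE] : exists j : {linear D -> W}, forall x, j x = f (i (0, x)).
    by exists (f \o (i \o pair_lin \0 idfun)).
  have [//|x /fx[u <-]|k kE] := @linear_factor _ _ _ _ f q.
    by rewrite phiE (exact_at_comp0 _ iq).
  apply: (closed (f := j) (g := k)) Ng; last exact: FC_GC_flat.
  split=> [|w|z].
  - apply: linear_eq0 => x; rewrite jE => /fx[u]; rewrite phiE => /iI[_ <-] //.
  - have [e <-] := fS w; rewrite kE; split=> [/iq[[u x] <-]|[x]].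
      exists x; rewrite jE; apply/eqP; rewrite -subr_eq0 -linearB; apply/eqP/fx.
      exists (- u); rewrite phiE -linearB; congr (i _); congr (_, _) => /=.
        by rewrite sub0r.
      by rewrite subrr.
    by rewrite jE -kE => <-; rewrite kE (exact_at_comp0 _ iq).
  - by have [y <-] := qS z; exists (f y); rewrite kE.
have [j jE] : exists j : {linear ('I_n -> C) -> (U' * E)%type}, forall c, j c = (p c, - b c).
  by exists (pair_lin p (\- b : {linear _ -> _})).
have [|k kE] := @linear_factor _ _ _ _ p (f \o b) pS.
  by move=> c /ap[u <-] /=; rewrite abE; exact: exact_at_comp0 fx.
have [g gE] : exists g : {linear (U' * E)%type -> W}, forall z, g z = k z.1 + f z.2.
  by exists (copair_lin k f).
apply: (closed (f := j) (g := g)) Wg; last exact/FC_GC_flat/FC_flat_pow.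
split=> [|[y e]|w].
- apply: linear_eq0 => c; rewrite jE => -[/ap[u uc] /eqP]; rewrite oppr_eq0 -uc abE phiE.
  rewrite -(raddf0 i) => /eqP/iI[->]; exact: raddf0.
- have [c <-] := pS y; rewrite gE kE /= -linearD.
  split=> [/fx[u uE]|[c' ]].
    exists (c - a u); rewrite jE !linearB (exact_at_comp0 _ ap) subr0 abE uE.
    by congr (_, _); rewrite -[LHS]/(- b c - - (b c + e)) opprK addKr.
  rewrite jE => -[pc' <-].
  have [u uE] : exists u, a u = c - c' by apply/ap; rewrite linearB pc' subrr.
  by apply/fx; exists u; rewrite -abE uE linearB.
- by have [e <-] := fS w; exists (0, e); rewrite gE /= raddf0 add0r.
Qed.

Lemma coresolvable_regular : coresolvable R^o.
Proof.
split; first exact: char_dualizable_regular.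
  exists 1%N, (fun _ => 1) => x; exists (fun _ => x); rewrite big_ord1.
  exact/esym/mulr1.
exists C; split; first exact: FC_flat_self.
have sL : linear (fun x : (R^o * C)%type => x.2) by [].
apply: (closed (f := pair_lin idfun \0) (g := mk_linear sL)) (FC_GC_flat tilting (FC_flat_self C)).
  split=> [|[x y]|z].
  - by move=> x y [].
  - by split=> [/= ->|[z [_ <-]]] //; exists x.
  - by exists (0, z).
exact: GC_flat_regular.
Qed.

Lemma finite_coresolution : exists (n : nat -> nat) (d0 : {linear R^o -> ('I_(n 0%N) -> C)})
    (d : forall k, {linear ('I_(n k) -> C) -> ('I_(n k.+1) -> C)}),
  [/\ forall x, d 0%N (d0 x) = 0, forall k x, d k.+1 (d k x) = 0 &
  forall Y, Prod_chr C Y -> [/\ injective (ltens Y d0), exact_at (ltens Y d0) (ltens Y (d 0%N))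
    & forall k, exact_at (ltens Y (d k)) (ltens Y (d k.+1))]].
Proof.
(* The state is a module with its [coresolvable] proof. Modules and maps come from the same chosen
   step, so the target of [p k] is the source of [a k.+1] by computation. *)
pose st := {U : lmodType R | coresolvable U}.
pose nxt (U : lmodType R) (t : {n : nat & {V : st & {linear U -> ('I_n -> C)} *
    {linear ('I_n -> C) -> sval V}}}%type) :=
  short_exact (projT2 (projT2 t)).1 (projT2 (projT2 t)).2 /\
  Prod_injective C (projT2 (projT2 t)).1.
have step (U : st) : {t | nxt (sval U) t}.
  apply: cid; have [n [U' [a [p [ap aY U'c]]]]] := coresolvable_step (svalP U).
  by exists (existT _ n (existT _ (exist _ U' U'c) (a, p))).
pose s0 : st := exist _ (R^o : lmodType R) coresolvable_regular.
pose s := fix s k : st := if k is j.+1 then projT1 (projT2 (sval (step (s j)))) else s0.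
pose n k := projT1 (sval (step (s k))).
pose a k : {linear sval (s k) -> ('I_(n k) -> C)} := (projT2 (projT2 (sval (step (s k))))).1.
pose p k : {linear ('I_(n k) -> C) -> sval (s k.+1)} := (projT2 (projT2 (sval (step (s k))))).2.
have ap k : short_exact (a k) (p k) := (svalP (step (s k))).1.
have aY k : Prod_injective C (a k) := (svalP (step (s k))).2.
have [d dE] : exists d : forall k, {linear ('I_(n k) -> C) -> ('I_(n k.+1) -> C)},
    forall k x, d k x = a k.+1 (p k x).
  by exists (fun k => a k.+1 \o p k).
have apE k x : p k (a k x) = 0 by have [_ H _] := ap k; apply: exact_at_comp0 H.
have ker Y k t : Prod_chr C Y -> ltens Y (d k) t = 0 <-> exists u, ltens Y (a k) u = t.
  move=> YP; have [_ ap' pS] := ap k.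
  rewrite -(ltens_comp (fun x => esym (dE k x))).
  apply: iff_trans (ltens_right_exact (Y := Y) ap' pS t); split=> [|->]; last exact: raddf0.
  by rewrite -(raddf0 (ltens Y (a k.+1))) => /(aY k.+1 Y YP).
exists n, (a 0%N), d; split=> [x|k x|Y YP].
- by rewrite dE apE raddf0.
- by rewrite !dE apE raddf0.
split=> [|t|k t]; [exact: aY|exact: ker|].
apply: iff_trans (ker Y k.+1 t YP) _.
have pT : forall t, exists s, ltens Y (p k) s = t.
  by have [_ _ pS] := ap k; apply: tens_surjective => // z; exists z.
have dT := ltens_comp (Y := Y) (fun x => esym (dE k x)).
split=> [[u <-]|[u <-]]; last by exists (ltens Y (p k) u); rewrite dT.
by have [v <-] := pT u; exists v; rewrite dT.
Qed.

End CoresolutionStep.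

Lemma Tor_eq0_of_rtens (R : pzRingType) (Y : lmodType R^c) (M : lmodType R)
    (Q : nat -> lmodType R^c) (q : forall n, {linear Q n.+1 -> Q n}) (c : {linear Q 0%N -> Y}) :
  projective_resolution q c -> (forall k, exact_at (rtens (q k.+1) M) (rtens (q k) M)) ->
  forall i, (1 <= i)%N -> Tor_eq0 i Y M.
Proof.
move=> res H [//|j] _ P d e /projective_flat_resolution Pres.
exact: (tor_balance res Pres).2.
Qed.

Lemma injective_surjective_bijective (A B : Type) (f : A -> B) :
  injective f -> (forall b, exists a, f a = b) -> bijective f.
Proof. by move=> fI /choice[g gP]; exists g => // a; apply: fI. Qed.

(** * The Bass class *)

Section RightHom.
Variables (R : pzRingType) (C : lmodType R).
Implicit Types (X : lmodType R) (s : endo C).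

(* Hom_R(X, C) as a right S-module: f s = s o f.                               *)
Definition hom_right X : Type := lhom X C.
HB.instance Definition _ X := GRing.Zmodule.on (hom_right X).

Section Structure.
Variable X : lmodType R.

Definition hom_right_scale (s : (endo C)^c) (f : hom_right X) : hom_right X :=
  (s : lhom C C) \o (f : lhom X C).

Let scaleA (a b : (endo C)^c) (f : hom_right X) :
  hom_right_scale a (hom_right_scale b f) = hom_right_scale (a * b) f.
Proof. by apply/lhomP. Qed.
Let scale1 : left_id (1 : (endo C)^c) hom_right_scale.
Proof. by move=> f; apply/lhomP. Qed.
Let scaleDr : right_distributive hom_right_scale +%R.
Proof. by move=> a f g; apply/lhomP => x /=; rewrite raddfD. Qed.
Let scaleDl (f : hom_right X) : {morph hom_right_scale^~ f : a b / a + b}.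
Proof. by move=> a b; apply/lhomP. Qed.

HB.instance Definition _ := GRing.Zmodule_isLmodule.Build (endo C)^c (hom_right X)
  scaleA scale1 scaleDr scaleDl.

End Structure.

Fact precomp_right_linear X X' (f : {linear X -> X'}) :
  linear (fun h : hom_right X' => (h : lhom X' C) \o f : hom_right X).
Proof. by move=> a g h; apply/lhomP. Qed.
Definition precomp_right X X' (f : {linear X -> X'}) : {linear hom_right X' -> hom_right X} :=
  mk_linear (precomp_right_linear f).

Lemma hom_right_pow n (f : hom_right ('I_n -> C)) :
  f = \sum_i (((f : lhom _ _) \o pow_in C i : endo C) : (endo C)^c) *:
    (pow_pr C i : hom_right ('I_n -> C)).
Proof.
apply/lhomP => x; rewrite {1}(pow_decomp x) linear_sum.
by elim/big_rec2: _ => // i u v _ ->.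
Qed.

(** Hom(C^n, C) is free over S on the coordinate projections; the coefficients of [h] are its
    restrictions to the factors. *)
Lemma projective_hom_right_pow n : projective (hom_right ('I_n -> C)).
Proof.
move=> A B p f pS.
have /choice[a aE] (i : 'I_n) : exists a, p a = f (pow_pr C i : hom_right ('I_n -> C)) by [].
have gL : linear (fun h : hom_right ('I_n -> C) =>
    \sum_i (((h : lhom _ _) \o pow_in C i : endo C) : (endo C)^c) *: a i).
  move=> s g h; rewrite scaler_sumr -big_split; apply: eq_bigr => i _ /=.
  by rewrite scalerA -scalerDl; congr (_ *: _); apply/lhomP.
exists (mk_linear gL) => h; rewrite mk_linearE [in RHS](hom_right_pow h) !linear_sum.
by apply: eq_bigr => i _; rewrite !linearZ_LR aE.
Qed.

Variable N : lmodType R.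

Fact hom_comp_balanced X : balanced (R := endo C)
  (fun (g : hom_right X) (f : hom_endo C N) => (f : lhom C N) \o (g : lhom X C) : lhom X N).
Proof.
split=> [g g' f|g f f'|s g f]; apply/lhomP => x //=.
exact: raddfD.
Qed.

Definition hom_comp X : {additive tens (R := endo C) (hom_right X) (hom_endo C N) -> lhom X N} :=
  sval (cid (tlift_exists (@hom_comp_balanced X))).

Lemma hom_compE X (g : hom_right X) (f : hom_endo C N) x :
  hom_comp X (tmul g f) x = (f : lhom C N) ((g : lhom X C) x).
Proof. by rewrite /hom_comp; case: cid => /= u ->. Qed.

Lemma hom_comp_precomp X X' (f : {linear X -> X'})
    (t : tens (R := endo C) (hom_right X') (hom_endo C N)) :
  hom_comp X (rtens (precomp_right f) (hom_endo C N) t) = precomp N f (hom_comp X' t).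
Proof.
apply: (@tens_ext (endo C) _ _ _ (hom_comp X \o rtens (precomp_right f) (hom_endo C N))
  (precomp N f \o hom_comp X')) => g h /=.
rewrite rtensE; apply/lhomP => x.
by rewrite hom_compE -[RHS]/(hom_comp X' (tmul g h) (f x)) hom_compE.
Qed.

Let hom_decomp n (h : lhom ('I_n -> C) N) : tens (R := endo C) (hom_right ('I_n -> C)) (hom_endo C N) :=
  \sum_i tmul (pow_pr C i : hom_right ('I_n -> C)) (precomp N (pow_in C i) h : hom_endo C N).

(** Both sides amount to n copies of Hom(C, N), because Hom(C^n, C) is free on the projections. *)
Lemma hom_comp_pow_bij n : cancel (hom_comp ('I_n -> C)) (@hom_decomp n) /\
  cancel (@hom_decomp n) (hom_comp ('I_n -> C)).
Proof.
have [mDl mDr mZ] := tmul_balanced (hom_right ('I_n -> C)) (hom_endo C N).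
split=> [t|h]; last first.
  rewrite /hom_decomp raddf_sum; apply/lhomP => x; rewrite {2}(pow_decomp x) linear_sum.
  elim/big_rec2: _ => // i u v _ <-; congr (_ + _); exact: hom_compE.
have addr_tmul (g : hom_right ('I_n -> C)) : zmod_morphism (fun f : hom_endo C N => tmul g f).
  by move=> u v; apply: (addIr (tmul g v)); rewrite -mDr !subrK.
have addl_tmul (f : hom_endo C N) : zmod_morphism (fun g : hom_right ('I_n -> C) => tmul g f).
  by move=> u v; apply: (addIr (tmul v f)); rewrite -mDl !subrK.
have dB : zmod_morphism (@hom_decomp n).
  move=> u v; rewrite /hom_decomp -sumrB; apply: eq_bigr => i _.
  by rewrite raddfB -addr_tmul.
apply: (@tens_ext (endo C) _ _ _ (mk_additive dB \o hom_comp ('I_n -> C)) idfun) => g f.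
rewrite -[LHS]/(hom_decomp (hom_comp _ (tmul g f))) -[RHS]/(tmul g f).
rewrite {2}(hom_right_pow g) -[RHS]/(mk_additive (addl_tmul f) _) raddf_sum.
apply: eq_bigr => i _; rewrite [RHS]mk_additiveE [RHS]mZ; congr (tmul _ _).
apply/lhomP => x; exact: hom_compE.
Qed.

Lemma hom_comp_inj n : injective (hom_comp ('I_n -> C)).
Proof. exact: can_inj (hom_comp_pow_bij n).1. Qed.

Lemma hom_comp_onto n (h : lhom ('I_n -> C) N) : exists t, hom_comp ('I_n -> C) t = h.
Proof. by exists (hom_decomp h); rewrite (hom_comp_pow_bij n).2. Qed.

Lemma bass_eval_additive : zmod_morphism (bass_eval (C := C) (N := N)).
Proof.
by apply: tlift_is_additive; split=> [c1 c2 g|c1 g1 g2|s c1 g] //=; exact: raddfD.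
Qed.

End RightHom.

(** * The Bass class expressed by exactness of Hom(X, N) *)

Section BassCriterion.
Variables (R : pzRingType) (C : lmodType R).
Variables (n : nat -> nat) (d0 : {linear R^o -> ('I_(n 0%N) -> C)}).
Variable (d : forall k, {linear ('I_(n k) -> C) -> ('I_(n k.+1) -> C)}).
Hypothesis dd0 : forall x, d 0%N (d0 x) = 0.
Hypothesis dd : forall k x, d k.+1 (d k x) = 0.
Hypothesis exT : forall Y, Prod_chr C Y ->
  [/\ injective (ltens Y d0), exact_at (ltens Y d0) (ltens Y (d 0%N))
    & forall k, exact_at (ltens Y (d k)) (ltens Y (d k.+1))].
Hypothesis Cd : char_dualizable C.
Implicit Types (N D L M : lmodType R).

(** Exactness of Hom(X, N) for the augmented complex X, including surjectivity onto Hom(R, N). Only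
    the inclusions of kernels in images are listed; the others come from [dd0] and [dd]. *)
Definition hom_exact N :=
  [/\ forall h : {linear R^o -> N}, exists k : {linear ('I_(n 0%N) -> C) -> N},
        forall x, h x = k (d0 x),
      forall h : {linear ('I_(n 0%N) -> C) -> N}, (forall x, h (d0 x) = 0) ->
        exists k : {linear ('I_(n 1%N) -> C) -> N}, forall x, h x = k (d 0%N x)
    & forall j (h : {linear ('I_(n j.+1) -> C) -> N}), (forall x, h (d j x) = 0) ->
        exists k : {linear ('I_(n j.+2) -> C) -> N}, forall x, h x = k (d j.+1 x)].

Let Pd k : char_dualizable ('I_(n k) -> C). Proof. exact: char_dualizable_pow. Qed.
Let Rd := @char_dualizable_regular R.

Lemma hom_exact_ltens N : hom_exact N <->
  [/\ injective (ltens (chr N) d0), exact_at (ltens (chr N) d0) (ltens (chr N) (d 0%N))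
    & forall k, exact_at (ltens (chr N) (d k)) (ltens (chr N) (d k.+1))].
Proof.
have zE t : ltens (chr N) (\0 : {linear R^o -> R^o}) t = 0.
  by apply: (@tens_ext _ _ _ _ (ltens _ \0) \0) => y x; rewrite [LHS]ltensE tmulr0.
(* Injectivity at [R^o] is read as exactness after a zero map, so that [char_dualizable_exact] also
   covers this end. *)
have inj : injective (ltens (chr N) d0) <->
    exact_at (ltens (chr N) (\0 : {linear R^o -> R^o})) (ltens (chr N) d0).
  split=> [dI t|H]; first split=> [dt|[u <-]].
  - by exists 0; rewrite zE; apply: dI; rewrite dt raddf0.
  - by rewrite zE raddf0.
  - by apply: raddf_inj => t /H[u <-]; rewrite zE.
split=> [[h0 h1 h2]|[t0 t1 t2]]; split.
- apply/inj/(char_dualizable_exact _ _ _ Rd Rd (Pd 0)) => h; split=> [_|_ x]; first exact: h0.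
  exact: raddf0.
- apply/(char_dualizable_exact _ _ _ Rd (Pd 0) (Pd 1)) => h; split=> [|[k kE] x]; first exact: h1.
  by rewrite kE dd0 raddf0.
- move=> j; apply/(char_dualizable_exact _ _ _ (Pd j) (Pd j.+1) (Pd j.+2)) => h.
  by split=> [|[k kE] x]; [exact: h2|rewrite kE dd raddf0].
- move=> h; apply/((char_dualizable_exact _ _ _ Rd Rd (Pd 0)).1 (inj.1 t0)) => x; exact: raddf0.
- by move=> h; apply: ((char_dualizable_exact _ _ _ Rd (Pd 0) (Pd 1)).1 t1 h).1.
- by move=> j h; apply: ((char_dualizable_exact _ _ _ (Pd j) (Pd j.+1) (Pd j.+2)).1 (t2 j) h).1.
Qed.

Lemma hom_exact_FC N : FC_flat C N -> hom_exact N.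
Proof. by move=> Nc; apply/hom_exact_ltens/exT. Qed.

(** Exactness of Hom(X, N) gives exactness of [N^+ (x) X], whose character dual is Hom(X, N^++). *)
Lemma hom_exact_bidual N : hom_exact N -> hom_exact (dual (chr N)).
Proof.
move=> /hom_exact_ltens[t0 t1 t2]; split=> [h|h|j h].
- have [phi phiE] := dual_tens h.
  have [psi psiE] := (character_injective _).1 t0 phi.
  have [k kE] := tens_dual psi; exists k => x; apply/dualP => y.
  by rewrite kE -ltensE psiE phiE.
- by apply: ((exact_ltens_dual _ _ _).1 t1 h).1.
- by apply: ((exact_ltens_dual _ _ _).1 (t2 j) h).1.
Qed.

Let G k : lmodType (endo C)^c := hom_right C ('I_(n k) -> C).
Let q k : {linear G k.+1 -> G k} := precomp_right C (d k).

Let c_linear : linear (fun g : G 0%N => (g : lhom ('I_(n 0%N) -> C) C) (d0 1) : right_endo C).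
Proof. by []. Qed.
Let c : {linear G 0%N -> right_endo C} := mk_linear c_linear.

(** This is [hom_exact] for [C] itself, with Hom(R, C) identified with [C] by evaluation at 1. *)
Let G_resolution : projective_resolution q c.
Proof.
have [h0 h1 h2] := hom_exact_FC (FC_flat_self C).
split=> [k|x|g|k g].
- exact: projective_hom_right_pow.
- have [k kE] := h0 (scale_lin (x : C)); exists k.
  by rewrite mk_linearE -kE mk_linearE scale1r.
- rewrite mk_linearE; split=> [g0|[k <-]]; last first.
    by rewrite -[LHS]/((k : lhom ('I_(n 1%N) -> C) C) (d 0%N (d0 1))) dd0 linear0.
  have [x|k kE] := h1 (g : lhom _ _).
    by rewrite -[x]mulr1 [d0 _](linearZ_LR d0) linearZ_LR g0 scaler0.
  by exists k; apply/lhomP => x; rewrite kE.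
- split=> [/lhomP g0|[h <-]]; last by apply/lhomP => x; rewrite /= dd raddf0.
  have [k' kE] := h2 k (g : lhom _ _) g0.
  by exists k'; apply/lhomP => x; rewrite kE.
Qed.

Section Criterion.
Variable N : lmodType R.

Let H : lmodType (endo C) := hom_endo C N.

Let exact_G k : exact_at (rtens (q k.+1) H) (rtens (q k) H) <->
  forall h : {linear ('I_(n k.+1) -> C) -> N}, (forall x, h (d k x) = 0) ->
    exists k' : {linear ('I_(n k.+2) -> C) -> N}, forall x, h x = k' (d k.+1 x).
Proof.
split=> [ex h hd|hex t].
  have [t tE] := hom_comp_onto (h : lhom _ _).
  have [|u uE] := (ex t).1.
    by apply: (@hom_comp_inj _ _ N); rewrite hom_comp_precomp tE raddf0; apply/lhomP.
  exists (hom_comp C N _ u) => x; have := hom_comp_precomp (N := N) (d k.+1) u.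
  by rewrite uE tE => /lhomP ->.
split=> [qt|[u <-]].
  have [x|k' kE] := hex (hom_comp C N _ t : lhom _ _).
    have := hom_comp_precomp (N := N) (d k) t; rewrite [rtens _ _ _]qt raddf0.
    by move/esym/lhomP/(_ x).
  have [u uE] := hom_comp_onto (k' : lhom _ _).
  exists u; apply: (@hom_comp_inj _ _ N); rewrite hom_comp_precomp uE.
  by apply/lhomP => x; rewrite kE.
apply: (@hom_comp_inj _ _ N); rewrite !hom_comp_precomp raddf0; apply/lhomP => x.
by rewrite /= dd raddf0.
Qed.

(** Through [hom_comp] the Bass evaluation becomes restriction along [d0], so its bijectivity
    concerns the two lowest places of Hom(X, N). *)
Let evalE t : bass_eval (rtens c H t) = hom_comp C N ('I_(n 0%N) -> C) t (d0 1).
Proof.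
have ad : zmod_morphism (fun t => hom_comp C N ('I_(n 0%N) -> C) t (d0 1)).
  by move=> u v; rewrite raddfB.
apply: (@tens_ext (endo C) _ _ _
  (mk_additive (@bass_eval_additive _ C N) \o rtens c H) (mk_additive ad)) => g f.
rewrite [RHS]mk_additiveE hom_compE -[LHS]/(bass_eval (rtens c H (tmul g f))).
by rewrite rtensE bass_evalE.
Qed.

Let cT : forall t, exists s, rtens c H s = t.
Proof.
have [_ cS _ _] := G_resolution.
by apply: tens_surjective => // z; exists z.
Qed.

Let cex : exact_at (rtens (q 0%N) H) (rtens c H).
Proof. by have [_ cS qc _] := G_resolution; apply: rtens_right_exact. Qed.

(** Surjectivity of the evaluation gives exactness at Hom(R, N), injectivity gives the next place,
    and vanishing of Tor gives all later ones. *)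
Lemma bass_hom_exact : bass C N -> hom_exact N.
Proof.
move=> [_ tor ev]; have rex := tor_acyclic_rtens G_resolution ((Tor_eq0_acyclic _ _).1 tor).
split=> [h|h hd0|j]; last exact/exact_G/rex.
  have [g gK Kg] := ev; have [t tE] := cT (g (h 1)).
  exists (hom_comp C N _ t) => x.
  by rewrite -[x]mulr1 [d0 _](linearZ_LR d0) !linearZ_LR -evalE tE Kg.
have [t tE] := hom_comp_onto (h : lhom _ _).
have [|u uE] := (cex t).1.
  apply: (bij_inj ev); rewrite evalE tE hd0.
  exact/esym/(raddf0 (mk_additive (@bass_eval_additive _ C N))).
exists (hom_comp C N _ u) => x; have := hom_comp_precomp (N := N) (d 0%N) u.
by rewrite [rtens _ _ _]uE tE => /lhomP ->.
Qed.

Lemma hom_exact_bass : (forall i, (1 <= i)%N -> Ext_eq0 i C N) -> hom_exact N -> bass C N.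
Proof.
move=> ext [h0 h1 h2]; split=> //.
  by apply: (Tor_eq0_of_rtens G_resolution) => k; apply/exact_G/h2.
apply: injective_surjective_bijective => [|y]; last first.
  have [k kE] := h0 (scale_lin y); have [t tE] := hom_comp_onto (k : lhom _ _).
  by exists (rtens c H t); rewrite evalE tE -kE mk_linearE scale1r.
apply: (raddf_inj (f := mk_additive (@bass_eval_additive _ C N))) => t.
have [u <-] := cT t; rewrite mk_additiveE evalE => u0; apply/cex.
have [x|k kE] := h1 (hom_comp C N _ u : lhom _ _).
  by rewrite -[x]mulr1 [d0 _](linearZ_LR d0) linearZ_LR u0 scaler0.
have [v vE] := hom_comp_onto (k : lhom _ _).
exists v; apply: (@hom_comp_inj _ _ N); rewrite hom_comp_precomp vE.
by apply/lhomP => x; rewrite kE.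
Qed.

End Criterion.
End BassCriterion.

(** * Both sides as F_C and C_C *)

(** [u] extends [h] only with values in [B]. Subtracting [v \o b] moves the values into the kernel
    of [p] and changes nothing on the image of [a]. *)
Lemma kernel_lift (R : pzRingType) (L B M X0 X1 X2 : lmodType R) (i : {linear L -> B})
    (p : {linear B -> M}) (a : {linear X0 -> X1}) (b : {linear X1 -> X2})
    (h : {linear X0 -> L}) (u : {linear X1 -> B}) (v : {linear X2 -> B}) :
  injective i -> exact_at i p -> (forall x, b (a x) = 0) ->
  (forall x, i (h x) = u (a x)) -> (forall x, p (u x) = p (v (b x))) ->
  exists k : {linear X1 -> L}, forall x, h x = k (a x).
Proof.
move=> iI ip ba hu puv.
have [x|k kE] := @linear_cofactor _ _ _ _ i (u \- (v \o b) : {linear X1 -> B}) iI.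
  by apply/ip; rewrite linearB puv subrr.
by exists k => x; apply: iI; rewrite kE /= ba raddf0 subr0 hu.
Qed.

Section Main.
Variables (R : pzRingType) (C : lmodType R).
Hypotheses (closed : GCF_closed C) (tilting : wplus_tilting C).
Hypothesis finite_res : degreewise_finite_projective_resolution C.
Implicit Types (L M N B : lmodType R).

Let C_fp : char_dualizable C /\ finitely_generated C.
Proof.
have [P [d [e [[Pp eS de dd] Pg]]]] := finite_res.
split; last exact: finitely_generated_onto eS (Pg 0%N).
by apply: (char_dualizable_cokernel de eS); apply: char_dualizable_projective.
Qed.

(** The tilting hypothesis gives Tor(N^+, C) = 0; on the degreewise finite resolution this is dual
    to Ext(C, N). *)
Lemma Ext_FC N : FC_flat C N -> forall i, (1 <= i)%N -> Ext_eq0 i C N.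
Proof.
move=> Nc [//|j] _ Q q c Qres.
have [P [d [e [res Pg]]]] := finite_res; have [Pp eS de dd] := res.
have Pd k := char_dualizable_projective (Pp k) (Pg k).
have tor := tor_acyclic_Prod tilting Nc (FC_flat_self C).
have ex := (flat_res_tor_acyclic _ (projective_flat_resolution res)).1 tor j.
apply: (ext_independent res Qres) => f.
exact: ((char_dualizable_exact _ _ _ (Pd _) (Pd _) (Pd _)).1 ex f).1.
Qed.

Lemma Ext_tor_acyclic L : (forall i, (1 <= i)%N -> Ext_eq0 i C L) -> tor_acyclic (chr L) C.
Proof.
have [P [d [e [res Pg]]]] := finite_res; have [Pp eS de dd] := res.
have Pd k := char_dualizable_projective (Pp k) (Pg k).
move=> ext; apply/(flat_res_tor_acyclic _ (projective_flat_resolution res)) => j.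
apply/(char_dualizable_exact _ _ _ (Pd _) (Pd _) (Pd _)) => h; split=> [|[k kE] x].
  exact: (ext j.+1 isT _ _ _ res).
by rewrite kE (resolution_complex _ res) raddf0.
Qed.

(** Ext^1(N, L^++) is dual to Tor_1(L^+, N). As N lies in F_C, its vanishing reduces to that of
    Tor(L^+, C), which is dual to Ext(C, L). *)
Lemma CC_cotorsion_bidual L : (forall i, (1 <= i)%N -> Ext_eq0 i C L) ->
  CC_cotorsion C (dual (chr L)).
Proof.
move=> ext N Nc; apply: Ext_dual_acyclic => //.
exact/(tor_acyclic_FC _ Nc)/Ext_tor_acyclic.
Qed.

Lemma Ext_kernel L B M (i : {linear L -> B}) (p : {linear B -> M}) :
  short_exact i p -> (forall f : {linear C -> M}, exists g : {linear C -> B}, forall x, p (g x) = f x) ->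
  (forall k, (1 <= k)%N -> Ext_eq0 k C B) -> (forall k, (1 <= k)%N -> Ext_eq0 k C M) ->
  forall k, (1 <= k)%N -> Ext_eq0 k C L.
Proof.
move=> [iI ip pS] lft exB exM [//|j] _ Q q c res f fq; have [Qp cS qc qq] := res.
have [x|u uE] := exB j.+1 isT _ _ _ res (i \o f); first by rewrite /= fq raddf0.
have puq x : p (u (q j x)) = 0 by rewrite -uE; apply: exact_at_comp0 ip.
(* In degree 1 the correction is a lift of a map [C -> M] to [B]; above it, Ext(C, M) = 0 gives a
   map [Q j -> M], lifted by projectivity. *)
case: j f fq u uE puq => [|j] f fq u uE puq.
  have [x /qc[y <-]|g gE] := @linear_factor _ _ _ _ c (p \o u) cS; first exact: puq.
  have [v vE] := lft g.
  apply: (kernel_lift (u := u) (v := v) (b := c) iI ip) => // [x|x].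
    exact: exact_at_comp0 qc.
  by rewrite vE gE.
have [g gE] := exM j.+1 isT _ _ _ res (p \o u) puq.
have [v vE] := Qp j _ _ p g pS.
apply: (kernel_lift (u := u) (v := v) (b := q j) iI ip) => // [x|x].
  exact: exact_at_comp0 (qq j).
by rewrite vE -gE.
Qed.

Lemma pow_lift B M (p : {linear B -> M}) m (f : {linear ('I_m -> C) -> M}) :
  (forall f : {linear C -> M}, exists g : {linear C -> B}, forall x, p (g x) = f x) ->
  exists g : {linear ('I_m -> C) -> B}, forall x, p (g x) = f x.
Proof.
move=> lft; have /choice[g gE] (i : 'I_m) := lft (f \o pow_in C i).
have gL : linear (fun x : 'I_m -> C => \sum_i g i (x i)).
  by move=> a x y; rewrite scaler_sumr -big_split; apply: eq_bigr => i _; exact: (linearP (g i)).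
exists (mk_linear gL) => x; rewrite mk_linearE [in RHS](pow_decomp x) !linear_sum.
by apply: eq_bigr => i _; rewrite gE.
Qed.

Lemma FC_flat_GC_cotorsion M : FC_flat C M -> CC_cotorsion C M -> GC_cotorsion C M.
Proof.
move=> Mc Mcot N Ng; apply: ext1_of_split => E f g fg.
have Eg : GC_flat C E by apply: closed fg _ Ng; exact: FC_GC_flat.
have [D [N1 [i [p [Dc N1g [iI ip pS] iY]]]]] := GC_flat_embedding tilting Eg.
have [Q [pi [fpi piS]]] := cokernel_exists (i \o f).
have [fI fgx gS] := fg.
have Qg : GC_flat C Q.
  have [x /fgx[m <-]|k kE] := @linear_factor _ _ _ _ g (pi \o i) gS.
    exact: (exact_at_comp0 m fpi).
  have [x /fpi[m <-]|l lE] := @linear_factor _ _ _ _ pi p piS.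
    exact: exact_at_comp0 ip.
  apply: (closed (f := k) (g := l)) Ng N1g; split=> [|z|z].
  - apply: linear_eq0 => y; have [x <-] := gS y; rewrite kE => /fpi[m /iI <-].
    exact: exact_at_comp0 fgx.
  - have [x <-] := piS z; rewrite lE; split=> [/ip[y <-]|[y]]; first by exists (g y); rewrite kE.
    have [y' <-] := gS y; rewrite kE /= => E'.
    by rewrite -lE -E' lE (exact_at_comp0 _ ip).
  - by have [x <-] := pS z; exists (pi x); rewrite lE.
have Qc : FC_flat C Q.
  have [D' [N2 [i' [p' [Dc' N2g ip' iY']]]]] := GC_flat_embedding tilting Qg.
  have se : short_exact (chr_map pi) (chr_map (i \o f)).
    split; [|exact: chr_exact|].
      move=> l l' /chrP ll; apply/chrP => z; have [x <-] := piS z; exact: ll.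
    move=> l; have ifI : injective (i \o f) by apply: inj_comp.
    by have [l' l'E] := (character_injective _).1 ifI l; exists l'; apply/chrP.
  have inj := rtens_injective (M := Q) se ((GC_flat_data Qg).1 _ Mc).
  have i'I : injective (ltens (chr Q) i').
    apply: raddf_inj => t t0; apply: inj; rewrite raddf0.
    apply: (iY' _ Dc); rewrite -rtens_ltens [X in rtens _ _ X]t0 !raddf0 //.
  have [psi psiE] := (character_injective _).1 i'I (tens_trace Q).
  have [s sE] := tens_chr psi.
  apply: (Prod_chr_retract (s := s) (r := chr_map i')) Dc' => l.
  by apply/chrP => x; rewrite -[LHS]/(s l (i' x)) sE -ltensE psiE tens_traceE.
have [|r rE] := ext1_extend (f := i \o f) (g := pi) idfun (Mcot Q Qc).
  by split=> //; apply: inj_comp.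
by exists (r \o i).
Qed.

Lemma GC_flat_cotorsion_FC M : GC_flat C M -> GC_cotorsion C M -> FC_flat C M.
Proof.
move=> Mg Mcot; have [D [N [i [p [Dc Ng ip _]]]]] := GC_flat_embedding tilting Mg.
have [r rE] := ext1_extend idfun (Mcot N Ng) ip.
exact: (FC_flat_retract rE).
Qed.

Lemma GC_cotorsion_CC M : GC_cotorsion C M -> CC_cotorsion C M.
Proof. by move=> Mcot N Nc; apply/Mcot/FC_GC_flat. Qed.

Lemma evaluation_linear L : linear (fun x : L =>
  mk_additive (fun l l' : chr L => erefl : (l - l') x = l x - l' x) : dual (chr L)).
Proof. by move=> a x y; apply/dualP => l; rewrite -[RHS]/(l (a *: x) + l y) -raddfD. Qed.

Lemma FC_flat_of_bidual_extension L B M (i : {linear L -> B}) (p : {linear B -> M}) :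
  short_exact i p -> FC_flat C B -> Ext_eq0 1 M (dual (chr L)) -> FC_flat C M.
Proof.
move=> ip Bc ext; have [E EE] := ext1_extend (mk_linear (@evaluation_linear L)) ext ip.
have [iI ipx pS] := ip.
have ad (l : chr L) : zmod_morphism (fun b => E b l) by move=> x y; rewrite linearB.
have sL : linear (fun l : chr L => mk_additive (ad l) : chr B).
  move=> a l l'; apply/chrP => b.
  by rewrite -[RHS]/(E ((a : R) *: b) l + E b l') linearZ_LR -[LHS]/(E b (a *: l + l')) raddfD.
have [s sE] : exists s : {linear chr L -> chr B}, forall l b, s l b = E b l by exists (mk_linear sL).
have pI : injective (chr_map p).
  by move=> l l' /chrP ll; apply/chrP => z; have [x <-] := pS z; exact: ll.
(* [s] is the transpose of [E] and a section of [chr_map i]. Hence [id - s \o chr_map i] has values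
   in the image of [chr_map p], which yields the retraction [r] onto [M^+]. *)
have [l|r rE] := @linear_cofactor _ _ _ _ (chr_map p) (idfun \- (s \o chr_map i) : {linear _ -> _}) pI.
  apply/(chr_exact ipx)/chrP => x; rewrite -[LHS]/(l (i x) - s (chr_map i l) (i x)) sE EE.
  exact: subrr.
apply: (Prod_chr_retract (s := chr_map p) (r := r)) Bc => l; apply: pI.
rewrite rE -[LHS]/(chr_map p l - s (chr_map i (chr_map p l))) (exact_at_comp0 _ (chr_exact ipx)) raddf0; exact: subr0.
Qed.

Lemma FC_flat_of_orth M : left_orth (capc (bass C) (CC_cotorsion C)) M -> bass C M -> FC_flat C M.
Proof.
move=> orth Mb; have [Cd Cg] := C_fp.
have [n [d0 [d [dd0 dd exT]]]] := finite_coresolution closed tilting Cd Cg.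
have Mh := bass_hom_exact dd0 dd exT Cd Mb; have [Mext _ _] := Mb.
(* One copy of [C] for each map [C -> M] makes all of these maps lift along [p]. *)
pose B : lmodType R := dsum (lhom C M) C.
have Bc : FC_flat C B by exact: FC_flat_dsum.
have [p pE] : exists p : {linear B -> M}, forall f x, p (dsum_in C f x) = f x.
  by exists (dsum_lift (fun f : lhom C M => f : {linear C -> M})) => f x; rewrite dsum_lift_in.
have lft (f : {linear C -> M}) : exists g : {linear C -> B}, forall x, p (g x) = f x.
  by exists (dsum_in C (f : lhom C M)) => x; rewrite pE.
(* Exactness of Hom(X, M) extends the map sending 1 to [y] to a finite power of [C], and maps from
   that power lift to [B]. *)
have pS y : exists x, p x = y.
  have [h0 _ _] := Mh; have [k kE] := h0 (scale_lin y); have [k' k'E] := pow_lift k lft.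
  by exists (k' (d0 1)); rewrite k'E -kE mk_linearE scale1r.
have [L [i [iI ipx]]] := kernel_exists p; have ip : short_exact i p by [].
have Lext := Ext_kernel ip lft (Ext_FC Bc) Mext.
(* Each place for [L] uses the same place for [B] and the next one for [M]; lifting a map from a
   power of [C] to [B] then supplies the correction in [kernel_lift]. *)
have Lh : hom_exact d0 d L.
  have [B0 B1 B2] := hom_exact_FC dd0 dd exT Cd Bc; have [M0 M1 M2] := Mh.
  split=> [h|h hd|j h hd].
  - have [u uE] := B0 (i \o h).
    have [x|g gE] := M1 (p \o u); first by rewrite /= -uE (exact_at_comp0 _ ipx).
    have [v vE] := pow_lift g lft.
    apply: (kernel_lift (u := u) (v := v) (b := d 0%N) iI ipx) => x.
    + exact: dd0.
    + exact: uE.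
    + by rewrite vE -gE.
  - have [x|u uE] := B1 (i \o h); first by rewrite /= hd raddf0.
    have [x|g gE] := M2 0%N (p \o u); first by rewrite /= -uE (exact_at_comp0 _ ipx).
    have [v vE] := pow_lift g lft.
    apply: (kernel_lift (u := u) (v := v) (b := d 1%N) iI ipx) => x.
    + exact: dd.
    + exact: uE.
    + by rewrite vE -gE.
  - have [x|u uE] := B2 j (i \o h); first by rewrite /= hd raddf0.
    have [x|g gE] := M2 j.+1 (p \o u); first by rewrite /= -uE (exact_at_comp0 _ ipx).
    have [v vE] := pow_lift g lft.
    apply: (kernel_lift (u := u) (v := v) (b := d j.+2) iI ipx) => x.
    + exact: dd.
    + exact: uE.
    + by rewrite vE -gE.
apply: (FC_flat_of_bidual_extension ip Bc); apply: orth; split; last exact: CC_cotorsion_bidual.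
apply: (hom_exact_bass dd0 dd exT Cd); last exact: hom_exact_bidual.
exact/Ext_dual_acyclic/Ext_tor_acyclic.
Qed.

Lemma FC_flat_bass M : FC_flat C M -> bass C M.
Proof.
move=> Mc; have [Cd Cg] := C_fp.
have [n [d0 [d [dd0 dd exT]]]] := finite_coresolution closed tilting Cd Cg.
by apply: (hom_exact_bass dd0 dd exT Cd); [exact: Ext_FC|exact: hom_exact_FC].
Qed.

End Main.

Theorem proposition4p14 (R : pzRingType) (C : lmodType R)
    (closed : GCF_closed C) (tilting : wplus_tilting C)
    (finite_res : degreewise_finite_projective_resolution C) :
  forall M : lmodType R,
    capc (GC_flat C) (GC_cotorsion C) M <->
    capc (left_orth (capc (bass C) (CC_cotorsion C)))
         (capc (bass C) (CC_cotorsion C)) M.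
Proof.
move=> M; split=> [[Mg Mcot]|[orth [Mb Mcot]]].
  have Mc := GC_flat_cotorsion_FC tilting Mg Mcot.
  split; first by move=> N [_]; apply.
  split; [exact: FC_flat_bass|exact: GC_cotorsion_CC].
have Mc := FC_flat_of_orth closed tilting finite_res orth Mb.
by split; [exact: FC_GC_flat|exact: FC_flat_GC_cotorsion].
Qed.
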